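(* The space $\mathrm{Sub}_3(S^1)$ of nonempty subsets of the circle $S^1$ with at most three elements is homeomorphic to the $3$-sphere $S^3$. The subspace $\mathrm{Sub}_1(S^1)\subset \mathrm{Sub}_3(S^1)$ of one-element subsets is contained in it as the trefoil knot, i.e. there is a homeomorphism $h:\mathrm{Sub}_3(S^1)\to S^3$ such that $h(\mathrm{Sub}_1(S^1))$ is the trefoil knot. The subspace $\mathrm{Sub}_2(S^1)\subset \mathrm{Sub}_3(S^1)$ of nonempty subsets with at most two elements is homeomorphic to the M\''obius band, and the boundary circle of this M\''obius band is that knot $\mathrm{Sub}_1(S^1)$.
   Context: For a topological space $X$ and $n\ge 1$, $\mathrm{Sub}_n(X)$ denotes the set of all nonempty subsets of $X$ with at most $n$ elements, with the quotient topology from the surjection $X^n\to \mathrm{Sub}_n(X)$, $(x_1,\dots,x_n)\mapsto\{x_1,\dots,x_n\}$. (Thus small neighbourhoods of a subset are given by small movements of its points, where points may collide and a point may split into several nearby points.) There are inclusions $X=\mathrm{Sub}_1(X)\subset \mathrm{Sub}_2(X)\subset \mathrm{Sub}_3(X)\subset\cdots$, where $x\in X$ is identified with the singleton $\{x\}$. The M\''obius band is the compact surface with boundary obtained from a rectangular strip by identifying one pair of opposite edges with opposite orientations; its boundary is a single circle. Write $S^3=\{(u,w)\in\mathbf{C}\times\mathbf{C}: |u|^2+|w|^2=1\}$. The trefoil knot is the $(2,3)$-torus knot in $S^3$: up to rescaling, the image of $S^1\ni z\mapsto (z^2,z^3)\in S^1\times S^1\subset S^3$, where the torus $S^1\times S^1$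 is rescaled by the factor $1/\sqrt{2}$ so as to lie in $S^3$. *)

(* Defs.v *)
From HB Require Import structures.
From mathcomp Require Import all_boot all_order all_algebra generic_quotient.
From mathcomp Require Import complex.
From mathcomp Require Import all_classical all_reals all_analysis.
Set Implicit Arguments.
Unset Strict Implicit.
Unset Printing Implicit Defensive.
Import Order.TTheory GRing.Theory Num.Theory.
Import numFieldNormedType.Exports.
Local Open Scope classical_set_scope.
Local Open Scope ring_scope.
Local Open Scope complex_scope.
Local Open Scope quotient_scope.
Local Open Scope card_scope.

Definition homeomorphism (X Y : topologicalType) (f : X -> Y) : Prop :=
  continuous f /\
  exists g : Y -> X, [/\ cancel f g, cancel g f & continuous g].

(* The topology, defined below, requires [n] to be a successor. *)
Definition Subs (n : nat) (X : Type) : Type :=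
  set_type [set A : set X | A !=set0 /\ A #<= `I_n].

Definition Subs_set (n : nat) (X : Type) (A : Subs n X) : set X := \val A.

Section FiniteSubsets.
Context (n : nat) (X : Type).

Lemma range_Subs (x : 'I_n.+1 -> X) :
  range x \in [set A : set X | A !=set0 /\ A #<= `I_n.+1].
Proof.
apply/mem_set; split; first by exists (x ord0), ord0.
by rewrite (card_le_eqr (@card_II n.+1)); exact: card_image_le.
Qed.

Definition Subs_pi (x : {ptws 'I_n.+1 -> X}) : Subs n.+1 X :=
  exist _ (range x) (range_Subs x).

Lemma Subs_pi_surj (A : Subs n.+1 X) : exists x, Subs_pi x = A.
Proof.
case: A => A PA; have [[a0 Aa0]] := set_mem PA.
rewrite (card_le_eqr (@card_II n.+1)) => /card_leP[f].
pose x (i : 'I_n.+1) := if pselect (exists a : A, val (f a) = i) is left e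
            then set_val (sval (cid e)) else a0.
exists x; apply: eq_sig_hprop => //=; apply/seteqP; split => [_ [i _ <-]|a Aa].
  by rewrite /x; case: pselect => // e; apply/set_mem/valP.
pose a' : A := exist _ a (mem_set Aa); exists (val (f a')) => //.
rewrite /x; case: pselect => [e|]; last by case; exists a'.
by case: cid => b /= /val_inj /(inj (in_setT _) (in_setT _)) ->.
Qed.

Definition Subs_repr (A : Subs n.+1 X) : {ptws 'I_n.+1 -> X} :=
  sval (cid (Subs_pi_surj A)).

Lemma Subs_reprK : cancel Subs_repr Subs_pi.
Proof. by move=> A; rewrite /Subs_repr; case: cid. Qed.

HB.instance Definition _ :=
  isQuotient.Build {ptws 'I_n.+1 -> X} (Subs n.+1 X) Subs_reprK.

End FiniteSubsets.

(* Quotient topology of [Subs_pi] from the product topology on [X ^ n.+1]. *)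
HB.instance Definition _ (n : nat) (X : topologicalType) :=
  Topological.copy (Subs n.+1 X) (quotient_topology (Subs n.+1 X)).

(* [Sub_k(X)] as a subset of [Sub_n(X)]; coerced to a type it carries the
   subspace topology. *)
Definition Subs_le (n : nat) (X : Type) (k : nat) : set (Subs n X) :=
  [set A | Subs_set A #<= `I_k].
Arguments Subs_le {n X} k.

(* [R[i]] itself has no declared topology; on [R[i]^o] it is the metric topology
   of the modulus. *)

Definition circle (R : realType) : set R[i]^o := [set z | `|z| = 1].
Arguments circle : clear implicits.

Definition sphere3 (R : realType) : set (R[i]^o * R[i]^o) :=
  [set p | `|p.1| ^+ 2 + `|p.2| ^+ 2 = 1].
Arguments sphere3 : clear implicits.

Definition trefoil (R : realType) : set (sphere3 R) :=
  [set p | exists2 z, circle R z &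
    set_val p = (z ^+ 2 / (Num.sqrt 2 : R)%:C, z ^+ 3 / (Num.sqrt 2 : R)%:C)].
Arguments trefoil : clear implicits.

Section Moebius.
Context (R : realType).

Definition strip : set (R * R) := `[0, 1] `*` `[0, 1].

Definition strip_glue (p q : strip) : bool :=
  let: (x, t) := set_val p in let: (y, u) := set_val q in
  [|| (x == y) && (t == u),
      [&& x == 0, y == 1 & u == 1 - t] |
      [&& x == 1, y == 0 & u == 1 - t]].

Lemma strip_glue_refl : reflexive strip_glue.
Proof. by rewrite /strip_glue => p; case: (set_val p) => x t; rewrite !eqxx. Qed.

Lemma strip_glue_sym : symmetric strip_glue.
Proof.
rewrite /strip_glue => p q; case: (set_val p) (set_val q) => [x t] [y u].
rewrite (eq_sym x y) (eq_sym t u); congr orb; rewrite orbC.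
have -> : (u == 1 - t) = (t == 1 - u) by apply/eqP/eqP => ->; rewrite subKr.
by congr orb; rewrite andbCA.
Qed.

Lemma strip_glue_trans : transitive strip_glue.
Proof.
rewrite /strip_glue => q p r.
case: (set_val q) (set_val p) (set_val r) => [y u] [x t] [z v].
have n10 := oner_eq0 R; have n01 : (0 == 1 :> R) = false by rewrite eq_sym.
move=> /or3P[/andP[/eqP-> /eqP->] //| |] /and3P[/eqP-> /eqP-> /eqP->].
- case/or3P=> [/andP[/eqP<- /eqP<-]|/and3P[]|/and3P[_ /eqP-> /eqP->]].
  + by rewrite !eqxx !orbT.
  + by rewrite n10.
  + by rewrite subKr !eqxx.
- case/or3P=> [/andP[/eqP<- /eqP<-]|/and3P[_ /eqP-> /eqP->]|/and3P[]].
  + by rewrite !eqxx !orbT.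
  + by rewrite subKr !eqxx.
  + by rewrite n01.
Qed.

Canonical strip_glue_equiv :=
  EquivRel strip_glue strip_glue_refl strip_glue_sym strip_glue_trans.

Definition moebius : Type := quotient_topology {eq_quot strip_glue_equiv}.

HB.instance Definition _ := Topological.on moebius.
HB.instance Definition _ := Quotient.on moebius.

(* The two edges of the strip that are not glued. *)
Definition moebius_boundary : set moebius :=
  [set \pi_moebius p |
    p in [set p : strip | (set_val p).2 = 0 \/ (set_val p).2 = 1]].

End Moebius.
Arguments moebius_boundary : clear implicits.

(* Main.v *)
Require Import Defs.
From mathcomp Require Import all_boot all_order all_algebra generic_quotient.
From mathcomp Require Import complex.
From mathcomp Require Import all_classical all_reals all_analysis.
From mathcomp Require Import ring lra.
Import Order.TTheory GRing.Theory Num.Theory.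
Import numFieldNormedType.Exports.
Local Open Scope classical_set_scope.
Set Implicit Arguments.
Unset Strict Implicit.
Unset Printing Implicit Defensive.

(** A triple of distinct points x, y, z of the circle is encoded by p = xyz and
    u = p I^*, where I is the incenter of the triangle.  The midpoints m of the
    three arcs are the roots of T^3 - u^* p T^2 - u T + p, and x, y, z are the
    three values of p / m^2.  For |p| = 1 and |u| < 1 the roots of this cubic
    always have modulus 1 and come from such a triple, so triples of distinct
    points form the open solid torus |u| < 1, |p| = 1.  On its boundary |u| = 1
    the points (u, p) and (u, u^3 / p) are the triples (a, a, b) and (a, b, b) of
    one and the same set {a, b}, with u = ab.  Hence Sub_3 embeds by
    u and w = (p + u^3 / p) / 2, and the image of (|u|^2 u, |w| w) meets every
    ray of C^2 exactly once: with U = u^3 / p^2 one has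
    u^3 / w^2 = 4 U / (1 + U)^2, which is Koebe's function, and this function
    identifies, in the closed unit disk, exactly the conjugate points of the
    boundary.  A singleton {z} has u = z^2 and w = z^3, which gives the trefoil.

    For Sub_2, the point (x, t) of the strip goes to the pair
    {exp (i pi (x + t)), exp (i pi (x - t))}, whose product and sum determine
    (x, t) up to the gluing.  Both maps are continuous bijections from a compact
    space to a Hausdorff space. *)

(** * The invariants of a triple *)

Section Invariants.
Local Open Scope ring_scope.
Variable C : numClosedFieldType.
Implicit Types x y z u w p m : C.

Lemma norm1_neq0 x : `|x| = 1 -> x != 0.
Proof. by move=> x1; rewrite -normr_gt0 x1 ltr01. Qed.

Lemma norm1_conjC x : `|x| = 1 -> x^* = x^-1.
Proof. by move=> x1; rewrite invC_norm x1 expr1n invr1 mul1r. Qed.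

Lemma norm1_sqr_dist x y : `|x| = 1 -> `|y| = 1 ->
  `|x - y| ^+ 2 = - (x - y) ^+ 2 / (x * y).
Proof.
move=> x1 y1; have x0 := norm1_neq0 x1; have y0 := norm1_neq0 y1.
rewrite normCK rmorphB /= !norm1_conjC//; field.
by rewrite x0 y0.
Qed.

Definition chord_sum x y z := `|y - z| + `|z - x| + `|x - y|.

(* The weighted mean of yz, zx, xy with the opposite chords as weights; since
   t / 0 = 0 it is x ^+ 2 when x = y = z. If I is the incenter of the triangle,
   then uinv is xyz times the conjugate of I. *)
Definition uinv x y z :=
  x ^+ 2 + (`|y - z| * (y * z - x ^+ 2) + `|z - x| * (z * x - x ^+ 2)
            + `|x - y| * (x * y - x ^+ 2)) / chord_sum x y z.

(* Invariant under p |-> u^3 / p when `|u| = 1, cf. winvxxy and winvxyy. *)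
Definition wpar u p := (p + u ^+ 3 / p) / 2.

Definition winv x y z := wpar (uinv x y z) (x * y * z).

Lemma chord_sum_ge0 x y z : 0 <= chord_sum x y z.
Proof. by rewrite /chord_sum !addr_ge0. Qed.

Lemma chord_sum_eq0 x y z : (chord_sum x y z == 0) = (x == y) && (x == z).
Proof.
rewrite /chord_sum !paddr_eq0 ?addr_ge0// !normr_eq0 !subr_eq0.
by apply/idP/idP => [/andP[/andP[_ /eqP->] ->]|/andP[/eqP<- /eqP<-]]; rewrite !eqxx.
Qed.

(** Division-free form, valid also when all three chords vanish; the symmetries of [uinv] are read
    off it. *)
Lemma chord_sum_uinv x y z : chord_sum x y z * uinv x y z =
  `|y - z| * (y * z) + `|z - x| * (z * x) + `|x - y| * (x * y).
Proof.
have [/eqP s0|s0] := eqVneq (chord_sum x y z) 0; last first.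
  rewrite /uinv mulrDr [X in _ + X]mulrCA divff// mulr1 /chord_sum; ring.
move: (s0); rewrite chord_sum_eq0 => /andP[/eqP<- /eqP<-].
by rewrite /chord_sum !subrr normr0; ring.
Qed.

Lemma uinvxxx x : uinv x x x = x ^+ 2.
Proof. by rewrite /uinv /chord_sum !subrr normr0; ring. Qed.

Lemma chord_sum_swap x y z : chord_sum y x z = chord_sum x y z.
Proof. by rewrite /chord_sum (distrC x z) (distrC z y) (distrC y x); ring. Qed.

Lemma chord_sum_rot x y z : chord_sum y z x = chord_sum x y z.
Proof. by rewrite /chord_sum; ring. Qed.

Lemma uinv_swap x y z : uinv y x z = uinv x y z.
Proof.
have [/eqP|s0] := eqVneq (chord_sum x y z) 0.
  by rewrite chord_sum_eq0 => /andP[/eqP<- _].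
apply: (mulfI s0); rewrite -{1}chord_sum_swap !chord_sum_uinv.
rewrite (distrC x z) (distrC z y) (distrC y x); ring.
Qed.

Lemma uinv_rot x y z : uinv y z x = uinv x y z.
Proof.
have [/eqP|s0] := eqVneq (chord_sum x y z) 0.
  by rewrite chord_sum_eq0 => /andP[/eqP<- /eqP<-].
by apply: (mulfI s0); rewrite -{1}chord_sum_rot !chord_sum_uinv; ring.
Qed.

Lemma uinvxxy x y : uinv x x y = x * y.
Proof.
have [<-|xy] := eqVneq x y; first by rewrite uinvxxx expr2.
have s0 : chord_sum x x y != 0 by rewrite chord_sum_eq0 eqxx.
apply: (mulfI s0); rewrite chord_sum_uinv /chord_sum subrr normr0; ring.
Qed.

Lemma uinvxyy x y : uinv x y y = x * y.
Proof. by rewrite -uinv_rot -uinv_rot uinv_rot uinvxxy mulrC. Qed.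

Lemma winv_swap x y z : winv y x z = winv x y z.
Proof. by rewrite /winv uinv_swap (mulrC y). Qed.

Lemma winv_rot x y z : winv y z x = winv x y z.
Proof. by rewrite /winv uinv_rot mulrC mulrA. Qed.

Lemma winvxxy x y : `|x| = 1 -> `|y| = 1 ->
  winv x x y = x * y * (x + y) / 2.
Proof.
move=> /norm1_neq0 x0 /norm1_neq0 y0; rewrite /winv /wpar uinvxxy; field.
by rewrite x0 y0.
Qed.

Lemma winvxyy x y : `|x| = 1 -> `|y| = 1 ->
  winv x y y = x * y * (x + y) / 2.
Proof.
by move=> x1 y1; rewrite -winv_rot winvxxy// (mulrC y) (addrC y).
Qed.

(** A weighted mean of points of the unit circle stays in the closed disk. *)
Lemma uinv_le1 x y z : `|x| = 1 -> `|y| = 1 -> `|z| = 1 -> `|uinv x y z| <= 1.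
Proof.
move=> x1 y1 z1; have [/eqP|s0] := eqVneq (chord_sum x y z) 0.
  rewrite chord_sum_eq0 => /andP[/eqP<- /eqP<-].
  by rewrite uinvxxx normrX x1 expr1n.
have sp : 0 < chord_sum x y z by rewrite lt_def s0 chord_sum_ge0.
rewrite -(ler_pM2l sp) -{1}(gtr0_norm sp) -normrM chord_sum_uinv mulr1.
rewrite /chord_sum; apply: le_trans (ler_normD _ _) (lerD _ _).
  apply: le_trans (ler_normD _ _) (lerD _ _).
    by rewrite !normrM normr_id y1 z1 !mulr1.
  by rewrite !normrM normr_id x1 z1 !mulr1.
by rewrite !normrM normr_id y1 x1 !mulr1.
Qed.

(* Equality in the triangle inequality would give y z = z x. *)
Lemma uinv_lt1 x y z : `|x| = 1 -> `|y| = 1 -> `|z| = 1 ->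
  x != y -> y != z -> z != x -> `|uinv x y z| < 1.
Proof.
move=> x1 y1 z1 xy yz zx; rewrite lt_neqAle uinv_le1// andbT.
apply/eqP => u1.
have sp : 0 < chord_sum x y z.
  by rewrite lt_def chord_sum_ge0 chord_sum_eq0 (negbTE xy).
have := congr1 Num.norm (chord_sum_uinv x y z).
rewrite normrM u1 mulr1 gtr0_norm// => e.
pose F (i : 'I_3) := tnth [tuple `|y - z| * (y * z); `|z - x| * (z * x);
  `|x - y| * (x * y)] i.
have [|t _ tF] := @normC_sum_eq C _ xpredT F.
  rewrite !big_ord_recl !big_ord0 /F /= !(tnth_nth 0) /= !addr0 !addrA -e.
  by rewrite /chord_sum !normrM !normr_id x1 y1 z1 !mulr1.
have h (a b c : C) : `|c| = 1 -> a != b ->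
    `|a - b| * c = `| `|a - b| * c| * t -> c = t.
  move=> c1 ab; rewrite normrM normr_id c1 mulr1 => /mulfI; apply.
  by rewrite normr_eq0 subr_eq0.
have yt : y * z = t.
  apply: (h y z) => //; first by rewrite normrM y1 z1 mulr1.
  exact: (tF ord0 isT).
have zt : z * x = t.
  apply: (h z x) => //; first by rewrite normrM x1 z1 mulr1.
  by have := tF (@Ordinal 3 1 isT) isT; rewrite /F !(tnth_nth 0).
move: yt; rewrite -zt mulrC => /(mulfI (norm1_neq0 z1)) /eqP.
by rewrite eq_sym (negbTE xy).
Qed.

(* With the unit edge vectors a, b, c, the midpoints of the arcs are
   b c / x, c a / y and a b / z. *)
Lemma arc_midpoints x y z : `|x| = 1 -> `|y| = 1 -> `|z| = 1 ->
  x != y -> y != z -> z != x ->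
  exists m1 m2 m3, [/\ `|m1| = 1, `|m2| = 1, `|m3| = 1,
    m1 * m2 * m3 = - (x * y * z) &
    m1 * m2 + m2 * m3 + m3 * m1 = - uinv x y z] /\
    [/\ x * m1 ^+ 2 = x * y * z, y * m2 ^+ 2 = x * y * z
      & z * m3 ^+ 2 = x * y * z].
Proof.
move=> x1 y1 z1 xy yz zx.
have x0 := norm1_neq0 x1; have y0 := norm1_neq0 y1; have z0 := norm1_neq0 z1.
have dist0 (a b : C) : a != b -> `|a - b| != 0 by rewrite normr_eq0 subr_eq0.
pose e (a b : C) : C := (a - b) / `|a - b|.
have e1 (a b : C) : a != b -> `|e a b| = 1.
  by move=> ab; rewrite normrM normfV normr_id divff// dist0.
have e2 (a b : C) : `|a| = 1 -> `|b| = 1 -> a != b -> e a b ^+ 2 = - (a * b).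
  move=> a1 b1 ab; rewrite expr_div_n norm1_sqr_dist//; field.
  by rewrite subr_eq0 ab !norm1_neq0.
have eE (a b : C) : a != b -> `|a - b| * e a b = a - b.
  by move=> ab; rewrite mulrC divfK// dist0.
have eVE (a b : C) : `|a| = 1 -> `|b| = 1 -> a != b ->
    `|a - b| / e a b = a^-1 - b^-1.
  move=> a1 b1 ab; rewrite -(norm1_conjC (e1 _ _ ab)).
  rewrite -(norm1_conjC a1) -(norm1_conjC b1).
  by rewrite -rmorphB /= -{1}(conj_normC (a - b)) -rmorphM /= eE.
set a := e y z; set b := e z x; set c := e x y.
have a1 : `|a| = 1 := e1 _ _ yz; have b1 : `|b| = 1 := e1 _ _ zx.
have c1 : `|c| = 1 := e1 _ _ xy.
have a2 : a ^+ 2 = - (y * z) := e2 _ _ y1 z1 yz.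
have b2 : b ^+ 2 = - (z * x) := e2 _ _ z1 x1 zx.
have c2 : c ^+ 2 = - (x * y) := e2 _ _ x1 y1 xy.
have aE : `|y - z| * a = y - z := eE _ _ yz.
have bE : `|z - x| * b = z - x := eE _ _ zx.
have cE : `|x - y| * c = x - y := eE _ _ xy.
have aV : `|y - z| / a = y^-1 - z^-1 := eVE _ _ y1 z1 yz.
have bV : `|z - x| / b = z^-1 - x^-1 := eVE _ _ z1 x1 zx.
have cV : `|x - y| / c = x^-1 - y^-1 := eVE _ _ x1 y1 xy.
clearbody a b c.
have a0 := norm1_neq0 a1; have b0 := norm1_neq0 b1; have c0 := norm1_neq0 c1.
exists (b * c / x), (c * a / y), (a * b / z); split; split.
- by rewrite !normrM normfV b1 c1 x1 invr1 !mulr1.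
- by rewrite !normrM normfV a1 c1 y1 invr1 !mulr1.
- by rewrite !normrM normfV a1 b1 z1 invr1 !mulr1.
- have -> : b * c / x * (c * a / y) * (a * b / z) =
    (a ^+ 2 * b ^+ 2 * c ^+ 2) / (x * y * z) by field; rewrite x0 y0 z0.
  by rewrite a2 b2 c2; field; rewrite x0 y0 z0.
- have -> : b * c / x * (c * a / y) + c * a / y * (a * b / z) +
      a * b / z * (b * c / x) = (a * b) * c ^+ 2 / (x * y) +
      (b * c) * a ^+ 2 / (y * z) + (c * a) * b ^+ 2 / (z * x).
    by field; rewrite x0 y0 z0.
  have s0 : chord_sum x y z != 0 by rewrite chord_sum_eq0 (negbTE xy).
  apply: (mulfI s0); rewrite mulrN chord_sum_uinv.
  have -> : y * z = - a ^+ 2 by rewrite a2 opprK.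
  have -> : z * x = - b ^+ 2 by rewrite b2 opprK.
  have -> : x * y = - c ^+ 2 by rewrite c2 opprK.
  apply/eqP; rewrite -subr_eq0 /chord_sum; apply/eqP.
  (* Both inner sums telescope to 0: the first is (y - z) + (z - x) + (x - y), the second is its
     analogue for the inverses. *)
  transitivity (- ((a + b + c) * (`|y - z| * a + `|z - x| * b + `|x - y| * c)
     + a * b * c * (`|y - z| / a + `|z - x| / b + `|x - y| / c))).
    by field; rewrite a0 b0 c0.
  rewrite aE bE cE aV bV cV; ring.
- by rewrite expr_div_n exprMn b2 c2; field.
- by rewrite expr_div_n exprMn a2 c2; field.
- by rewrite expr_div_n exprMn b2 a2; field.
Qed.

(** * Injectivity of the invariants on subsets of the circle *)

(** For unimodular numbers e1 = e3 e2^*, since conjugation is inversion. So e2 and e3 already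
    determine the cubic whose roots they are. *)
Lemma norm1_roots_sub (m1 m2 m3 n1 n2 n3 : C) :
  `|m1| = 1 -> `|m2| = 1 -> `|m3| = 1 -> `|n1| = 1 -> `|n2| = 1 -> `|n3| = 1 ->
  m1 * m2 * m3 = n1 * n2 * n3 ->
  m1 * m2 + m2 * m3 + m3 * m1 = n1 * n2 + n2 * n3 + n3 * n1 ->
  [\/ m1 = n1, m1 = n2 | m1 = n3].
Proof.
move=> m11 m21 m31 n11 n21 n31 e3 e2.
have E1 (a b c : C) : `|a| = 1 -> `|b| = 1 -> `|c| = 1 ->
    a + b + c = a * b * c * (a * b + b * c + c * a)^*.
  move=> a1 b1 c1; rewrite !rmorphD !rmorphM /= !norm1_conjC//; field.
  by rewrite !norm1_neq0.
have e1 : m1 + m2 + m3 = n1 + n2 + n3.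
  by rewrite (E1 m1 m2 m3)// (E1 n1 n2 n3)// e2 e3.
have : (m1 - n1) * (m1 - n2) * (m1 - n3) = 0.
  transitivity (m1 ^+ 3 - (n1 + n2 + n3) * m1 ^+ 2
     + (n1 * n2 + n2 * n3 + n3 * n1) * m1 - n1 * n2 * n3); first by ring.
  by rewrite -e1 -e2 -e3; ring.
move/eqP; rewrite !mulf_eq0 !subr_eq0 => /orP[/orP[]|] /eqP;
  by [apply: Or31|apply: Or32|apply: Or33].
Qed.

(** Separates the interior of the solid torus from its boundary. On a degenerate triple the
    invariants depend only on the underlying pair, not on which point is doubled. *)
Lemma triple_dichotomy x y z : `|x| = 1 -> `|y| = 1 -> `|z| = 1 ->
  [/\ x != y, y != z & z != x] \/
  exists a b, [/\ `|a| = 1, `|b| = 1, [:: x; y; z] =i [:: a; b],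
    uinv x y z = a * b & winv x y z = a * b * (a + b) / 2].
Proof.
move=> x1 y1 z1; have [<-|xy] := eqVneq x y.
  right; exists x, z; split; rewrite ?uinvxxy ?winvxxy// => t.
  by rewrite !inE orbA orbb.
have [<-|yz] := eqVneq y z.
  right; exists y, x; rewrite -uinv_rot -winv_rot; split;
    rewrite ?uinvxxy ?winvxxy// => t.
  by rewrite !inE orbC orbb.
have [<-|zx] := eqVneq z x; last by left.
right; exists z, y; rewrite uinv_rot winv_rot; split; rewrite ?uinvxxy ?winvxxy// => t.
by rewrite !inE orbCA orbb orbC.
Qed.

Lemma pair_of_sum_prod (a b c d : C) : a * b = c * d -> a + b = c + d ->
  [:: a; b] =i [:: c; d].
Proof.
move=> ab_cd abcd; have: (a - c) * (a - d) = 0.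
  transitivity (a ^+ 2 - (c + d) * a + c * d); first by ring.
  by rewrite -abcd -ab_cd; ring.
move/eqP; rewrite mulf_eq0 !subr_eq0 => /orP[] /eqP ac t; rewrite !inE.
  by move: abcd; rewrite ac => /addrI->.
by move: abcd; rewrite ac addrC => /addIr->; rewrite orbC.
Qed.

(** As 1 / p and 1 / q are conjugates, equality reads p - q = - u^3 (p - q)^*, and comparing moduli
    with |u| < 1 leaves only p = q. *)
Lemma wpar_inj u p q : `|u| < 1 -> `|p| = 1 -> `|q| = 1 ->
  wpar u p = wpar u q -> p = q.
Proof.
move=> u1 p1 q1 /(divIf (_ : 2 != 0)); rewrite pnatr_eq0 => /(_ isT) e.
have {e} : p - q = - u ^+ 3 * (p - q)^*.
  rewrite rmorphB /= !norm1_conjC//; apply/eqP; rewrite -subr_eq0.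
  have -> : p - q - - u ^+ 3 * (p^-1 - q^-1) =
     p + u ^+ 3 / p - (q + u ^+ 3 / q) by ring.
  by rewrite e subrr.
move/(congr1 Num.norm); rewrite normrM normrN normrX norm_conjC => /eqP.
rewrite -[X in X == _]mul1r -subr_eq0 -mulrBl mulf_eq0 !subr_eq0.
move=> /orP[/eqP u31|]; last by rewrite normr_eq0 subr_eq0 => /eqP.
by have := @exprn_ilt1 C 3 `|u| (normr_ge0 u) u1; rewrite -u31 ltxx.
Qed.

(** The modulus of u tells distinct triples from degenerate ones, which excludes the mixed cases.
    For distinct triples, u and w give p, then the arc midpoints as roots of one cubic, then x = p /
    m1^2. For degenerate ones, u and w give the product and the sum of the pair. *)
Lemma triple_inv_sub x y z x' y' z' :
  `|x| = 1 -> `|y| = 1 -> `|z| = 1 -> `|x'| = 1 -> `|y'| = 1 -> `|z'| = 1 ->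
  uinv x y z = uinv x' y' z' -> winv x y z = winv x' y' z' ->
  x \in [:: x'; y'; z'].
Proof.
move=> x1 y1 z1 x1' y1' z1' uu ww.
have [[xy yz zx]|[a [b [a1 b1 xyz uE wE]]]] := triple_dichotomy x1 y1 z1;
have [[xy' yz' zx']|[a' [b' [a1' b1' xyz' uE' wE']]]] :=
  triple_dichotomy x1' y1' z1'.
- have ult := uinv_lt1 x1 y1 z1 xy yz zx.
  have p1 : `|x * y * z| = 1 by rewrite !normrM x1 y1 z1 !mulr1.
  have p1' : `|x' * y' * z'| = 1 by rewrite !normrM x1' y1' z1' !mulr1.
  have pp : x * y * z = x' * y' * z'.
    by apply: (wpar_inj ult) => //; rewrite {2}uu.
  have [m1 [m2 [m3 [[m11 m21 m31 e3 e2]]]]] := arc_midpoints x1 y1 z1 xy yz zx.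
  move=> [xm _ _].
  have [n1 [n2 [n3 [[n11 n21 n31 f3 f2]]]]] :=
    arc_midpoints x1' y1' z1' xy' yz' zx'.
  move=> [xn yn zn].
  have m0 : m1 ^+ 2 != 0 by rewrite expf_neq0// norm1_neq0.
  have xE n t : m1 = n -> t * n ^+ 2 = x' * y' * z' -> x = t.
    by move=> <- tn; apply: (mulIf m0); rewrite xm tn.
  rewrite !inE; have [] := @norm1_roots_sub m1 m2 m3 n1 n2 n3.
  + by [].
  + by [].
  + by [].
  + by [].
  + by [].
  + by [].
  + by rewrite e3 f3 pp.
  + by rewrite e2 f2 uu.
  + by move=> /xE/(_ xn)->; rewrite eqxx.
  + by move=> /xE/(_ yn)->; rewrite eqxx orbT.
  + by move=> /xE/(_ zn)->; rewrite eqxx !orbT.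
- have := uinv_lt1 x1 y1 z1 xy yz zx.
  by rewrite uu uE' normrM a1' b1' mulr1 ltxx.
- have := uinv_lt1 x1' y1' z1' xy' yz' zx'.
  by rewrite -uu uE normrM a1 b1 mulr1 ltxx.
- have ab : a * b = a' * b' by rewrite -uE -uE' uu.
  have ab0 : a * b != 0 by rewrite mulf_neq0// norm1_neq0.
  have t0 : (2%:R : C)^-1 != 0 by rewrite invr_eq0 pnatr_eq0.
  have abD : a + b = a' + b'.
    by apply: (mulfI ab0); apply: (mulIf t0); rewrite -wE ww wE' ab.
  by rewrite xyz' -(pair_of_sum_prod ab abD) -xyz inE eqxx.
Qed.

Lemma triple_inv_inj x y z x' y' z' :
  `|x| = 1 -> `|y| = 1 -> `|z| = 1 -> `|x'| = 1 -> `|y'| = 1 -> `|z'| = 1 ->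
  uinv x y z = uinv x' y' z' -> winv x y z = winv x' y' z' ->
  [:: x; y; z] =i [:: x'; y'; z'].
Proof.
have sub (a b c a' b' c' : C) : `|a| = 1 -> `|b| = 1 -> `|c| = 1 ->
  `|a'| = 1 -> `|b'| = 1 -> `|c'| = 1 ->
  uinv a b c = uinv a' b' c' -> winv a b c = winv a' b' c' ->
  {subset [:: a; b; c] <= [:: a'; b'; c']}.
  move=> a1 b1 c1 a1' b1' c1' uu ww t tA.
  have {tA} : [|| t == a, t == b | t == c] by rewrite !inE in tA.
  case/or3P=> /eqP->.
  - exact: triple_inv_sub uu ww.
  - by apply: (@triple_inv_sub b c a) => //; rewrite (uinv_rot, winv_rot).
  - by apply: (@triple_inv_sub c a b) => //; rewrite -(uinv_rot, winv_rot).
move=> x1 y1 z1 x1' y1' z1' uu ww t.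
by apply/idP/idP; apply: sub.
Qed.

(** * Injectivity along rays *)

(** Both pairs have the same u^3 / w^2, used in cross-multiplied form to allow zeros. This forces
    |V| = |U|, hence |u'| = |u|, and c is read off from the moduli of u^3, or of w^2 when u = 0. *)
Lemma wpar_scale_eq1 u p u' p' (c : C) : `|u| <= 1 -> `|u'| <= 1 ->
  `|p| = 1 -> `|p'| = 1 -> 0 < c ->
  u' ^+ 3 = c * u ^+ 3 -> wpar u' p' ^+ 2 = c * wpar u p ^+ 2 -> c = 1.
Proof.
move=> u1 u1' p1 p1' c0 u3 w2.
have p0 := norm1_neq0 p1; have p0' := norm1_neq0 p1'.
have U1 (v q : C) : `|v| <= 1 -> `|q| = 1 -> `|v ^+ 3 / q ^+ 2| <= 1.
  move=> v1 q1; rewrite normrM normfV !normrX q1 expr1n invr1 mulr1.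
  by rewrite exprn_ile1.
have UE (v q : C) : `|q| = 1 -> `|v ^+ 3 / q ^+ 2| = `|v| ^+ 3.
  by move=> q1; rewrite normrM normfV !normrX q1 expr1n invr1 mulr1.
pose U := u ^+ 3 / p ^+ 2; pose V := u' ^+ 3 / p' ^+ 2.
(* Koebe's function U / (1 + U) ^ 2 identifies U only with its inverse. *)
have : (V - U) * (1 - U * V) = 0.
  have e : u ^+ 3 * wpar u' p' ^+ 2 = u' ^+ 3 * wpar u p ^+ 2.
    by rewrite w2 u3; ring.
  transitivity ((u' ^+ 3 * wpar u p ^+ 2 - u ^+ 3 * wpar u' p' ^+ 2) * 4
      / (p ^+ 2 * p' ^+ 2)).
    by rewrite /U /V /wpar; field; rewrite p0 p0'.
  by rewrite e subrr !mul0r.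
move=> /eqP; rewrite mulf_eq0 subr_eq0 => UV.
have {UV} : `|V| = `|U|.
  case/orP: UV => [/eqP->//|]; rewrite subr_eq0 => /eqP/(congr1 Num.norm).
  rewrite normr1 normrM => UV.
  have le1 (a b : C) : 0 <= a -> 0 <= b -> a <= 1 -> b <= 1 -> 1 = a * b -> a = 1.
    move=> a0 b0 a1 b1 ab; apply/eqP; rewrite eq_le a1 ab ler_piMr//.
  rewrite (le1 _ _ _ _ _ _ UV) ?U1//.
  by rewrite mulrC in UV; rewrite (le1 _ _ _ _ _ _ UV) ?U1.
rewrite /U /V !UE// => uu.
have [u0|u0] := eqVneq u 0.
  have u0' : u' = 0.
    by move: u3; rewrite u0 expr0n /= mulr0 => /eqP; rewrite expf_eq0 => /eqP.
  move: w2; rewrite /wpar u0 u0' expr0n /= !mul0r !addr0 => /(congr1 Num.norm).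
  rewrite normrX [in RHS]normrM normrX !normrM p1 p1' (gtr0_norm c0) !mul1r normfV.
  rewrite -[LHS]mul1r => /mulIf -> //.
  by rewrite expf_neq0// invr_eq0 normr_eq0 pnatr_eq0.
have := congr1 Num.norm u3; rewrite !(normrX, normrM) uu (gtr0_norm c0).
rewrite -[LHS]mul1r => /mulIf -> //.
by rewrite expf_neq0// normr_eq0.
Qed.

(** Cubing the first equation and cancelling c^2 |u|^6 gives u'^3 = c u^3; squaring the second and
    cancelling c |w|^2 gives w'^2 = c w^2. Hence c = 1, and u and w are recovered because |z|^k z
    determines z. *)
Lemma ray_invariants_inj u p u' p' (c : C) : `|u| <= 1 -> `|u'| <= 1 ->
  `|p| = 1 -> `|p'| = 1 -> 0 < c ->
  let w := wpar u p in let w' := wpar u' p' in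
  `|u'| ^+ 2 * u' = c * (`|u| ^+ 2 * u) -> `|w'| * w' = c * (`|w| * w) ->
  [/\ c = 1, u' = u & w' = w].
Proof.
move=> u1 u1' p1 p1' c0 w w' uu ww.
have nu : `|u'| ^+ 3 = c * `|u| ^+ 3.
  move/(congr1 Num.norm): uu; rewrite !(normrX, normrM) !normr_id (gtr0_norm c0).
  by rewrite -!exprSr.
have u3 : u' ^+ 3 = c * u ^+ 3.
  have [u0|u0] := eqVneq u 0.
    move: nu; rewrite u0 normr0 expr0n /= mulr0 => /eqP; rewrite expf_eq0 /=.
    by rewrite normr_eq0 => /eqP->; rewrite expr0n.
  have n0 : c ^+ 2 * `|u| ^+ 6 != 0.
    by rewrite mulf_neq0// ?expf_neq0// ?normr_eq0// gt_eqF.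
  apply: (mulfI n0).
  have -> : c ^+ 2 * `|u| ^+ 6 * (c * u ^+ 3) = (c * (`|u| ^+ 2 * u)) ^+ 3 by ring.
  have -> : c ^+ 2 * `|u| ^+ 6 = (c * `|u| ^+ 3) ^+ 2 by ring.
  by rewrite -nu -uu; ring.
have c1 : w' ^+ 2 = c * w ^+ 2 -> c = 1 := wpar_scale_eq1 u1 u1' p1 p1' c0 u3.
clearbody w w'.
have nw : `|w'| ^+ 2 = c * `|w| ^+ 2.
  by move/(congr1 Num.norm): ww; rewrite !normrM !normr_id (gtr0_norm c0).
have w2 : w' ^+ 2 = c * w ^+ 2.
  have [w0|w0] := eqVneq w 0.
    move: nw; rewrite w0 normr0 expr0n /= mulr0 => /eqP; rewrite expf_eq0 /=.
    by rewrite normr_eq0 => /eqP->; rewrite expr0n.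
  have n0 : c * `|w| ^+ 2 != 0.
    by rewrite mulf_neq0// ?expf_neq0// ?normr_eq0// gt_eqF.
  apply: (mulfI n0).
  have -> : c * `|w| ^+ 2 * (c * w ^+ 2) = (c * (`|w| * w)) ^+ 2 by ring.
  by rewrite -nw -ww; ring.
have {}c1 := c1 w2; split=> //.
  move: nu; rewrite c1 mul1r => /eqP; rewrite eqrXn2// => /eqP nu.
  have [u0|u0] := eqVneq u 0.
    by apply/eqP; rewrite u0 -normr_eq0 nu u0 normr0.
  by move: uu; rewrite c1 mul1r nu => /mulfI; apply; rewrite expf_neq0 ?normr_eq0.
move: nw; rewrite c1 mul1r => /eqP; rewrite eqrXn2// => /eqP nw.
have [w0|w0] := eqVneq w 0.
  by apply/eqP; rewrite w0 -normr_eq0 nw w0 normr0.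
by move: ww; rewrite c1 mul1r nw => /mulfI; apply; rewrite normr_eq0.
Qed.

(* |m| |m^2 - u| = |1 - u^* m^2|, while the squares of the last two moduli
   differ by (|m|^4 - 1)(1 - |u|^2). *)
Lemma selfinversive_root_norm1 u p m : `|u| < 1 -> `|p| = 1 ->
  m ^+ 3 - u^* * p * m ^+ 2 - u * m + p = 0 -> `|m| = 1.
Proof.
move=> u1 p1 m0.
have E : m * (m ^+ 2 - u) = - p * (1 - u^* * m ^+ 2).
  by apply/eqP; rewrite -subr_eq0 -m0; apply/eqP; ring.
have N : `|m| ^+ 2 * `|m ^+ 2 - u| ^+ 2 = `|1 - u^* * m ^+ 2| ^+ 2.
  by rewrite -exprMn -normrM E normrM normrN p1 mul1r.
set n := `|m| ^+ 2 in N *; set A := `|m ^+ 2 - u| ^+ 2 in N *.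
have D : A - n * A = (n ^+ 2 - 1) * (1 - `|u| ^+ 2).
  rewrite N /A /n !normCK !rmorphB !rmorphM /= !conjCK rmorph1; ring.
(* By [D] the expression factors; its second factor is positive because |u| < 1, so n = |m|^2 must
   be 1. *)
have : (1 - n) * (A + (n + 1) * (1 - `|u| ^+ 2)) = 0.
  transitivity (A - n * A - (n ^+ 2 - 1) * (1 - `|u| ^+ 2)); first by ring.
  by rewrite D subrr.
move/eqP; rewrite mulf_eq0 => /orP[|/eqP F].
  rewrite subr_eq0 eq_sym /n => /eqP n1; apply/eqP.
  by rewrite -(@eqrXn2 _ 2)// ?n1 ?expr1n ?ler01.
have : 0 < A + (n + 1) * (1 - `|u| ^+ 2).
  rewrite ltr_wpDl ?exprn_ge0// mulr_gt0//.
    by rewrite ltr_wpDl ?exprn_ge0.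
  by rewrite subr_gt0 exprn_ilt1.
by rewrite F ltxx.
Qed.

(** * Triples with prescribed u and p *)

Lemma cubic_roots (a b c : C) : exists r s t, forall x,
  x ^+ 3 - a * x ^+ 2 + b * x - c = (x - r) * (x - s) * (x - t).
Proof.
pose P := Poly [:: - c; b; - a; 1].
have PE : polyseq P = [:: - c; b; - a; 1] by rewrite (PolyK (c := 0)) ?oner_eq0.
have [rs rsE] := closed_field_poly_normal P.
move: rsE; rewrite lead_coefE PE /= scale1r => rsE.
have : size P = (size rs).+1 by rewrite rsE size_prod_XsubC.
rewrite PE; case: rs rsE => [|r [|s [|t []]]]//= rsE _.
exists r, s, t => x; have := congr1 (horner^~ x) rsE.
rewrite !big_cons big_nil mulr1 !hornerM !hornerXsubC mulrA => <-.
by rewrite /P horner_Poly /=; ring.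
Qed.

Lemma norm1_triple_surj u p : `|u| < 1 -> `|p| = 1 ->
  exists m1 m2 m3, [/\ `|m1| = 1, `|m2| = 1, `|m3| = 1, m1 * m2 * m3 = - p &
    m1 * m2 + m2 * m3 + m3 * m1 = - u].
Proof.
move=> u1 p1; have [m1 [m2 [m3 mE]]] := cubic_roots (u^* * p) (- u) (- p).
have e3 : m1 * m2 * m3 = - p.
  transitivity (- ((0 - m1) * (0 - m2) * (0 - m3))); first by ring.
  by rewrite -mE; ring.
have root m : (m - m1) * (m - m2) * (m - m3) = 0 -> `|m| = 1.
  by rewrite -mE => m0; apply: (selfinversive_root_norm1 u1 p1); rewrite -m0; ring.
exists m1, m2, m3; split=> //.
- by apply: root; rewrite subrr !mul0r.
- by apply: root; rewrite subrr mulr0 mul0r.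
- by apply: root; rewrite subrr mulr0.
(* The values of the monic cubic at 1 and -1 differ by 2 + 2 e2, with e2 the sum of the pairwise
   products of the roots. *)
have t0 : (2%:R : C) != 0 by rewrite pnatr_eq0.
apply: (mulfI t0).
have := mE 1; have := mE (- 1) => ea eb.
transitivity ((1 - m1) * (1 - m2) * (1 - m3) - (-1 - m1) * (-1 - m2) * (-1 - m3) - 2);
  first by ring.
rewrite -ea -eb; ring.
Qed.

(** For m_j = exp (i t_j) the expression is 4 sin (t1 - t2) sin (t2 - t3), so the cyclic sines share
    one strict sign. This gives the three chords in [uinv_surj] a common phase. *)
Lemma sine_prod_gt0 m1 m2 m3 : `|m1| = 1 -> `|m2| = 1 -> `|m3| = 1 ->
  `|m1 * m2 + m2 * m3 + m3 * m1| < 1 ->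
  0 < - ((m1 / m2 - m2 / m1) * (m2 / m3 - m3 / m2)).
Proof.
move=> m11 m21 m31 lt1; set e2 := m1 * m2 + m2 * m3 + m3 * m1.
have -> : - ((m1 / m2 - m2 / m1) * (m2 / m3 - m3 / m2)) =
   `|m1 + m2| ^+ 2 * `|m2 + m3| ^+ 2 + 2 * (1 - `|e2| ^+ 2).
  rewrite /e2 !normCK !rmorphD !rmorphM /= !norm1_conjC//; field.
  by rewrite !norm1_neq0.
rewrite ltr_wpDl ?mulr_ge0 ?exprn_ge0// mulr_gt0 ?ltr0n//.
by rewrite subr_gt0 exprn_ilt1.
Qed.

(** The construction of the arc midpoints is reversed. The chords y - z, z - x, x - y are m1 s1, m2
    s2, m3 s3 with s1, s2, s3 imaginary of one sign, so their lengths are proportional to the s_j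
    and the weighted mean becomes a rational identity. *)
Lemma uinv_surj u p : `|u| < 1 -> `|p| = 1 ->
  exists x y z, [/\ `|x| = 1, `|y| = 1, `|z| = 1, x * y * z = p & uinv x y z = u].
Proof.
move=> u1 p1.
have [m1 [m2 [m3 [m11 m21 m31 e3 e2]]]] := norm1_triple_surj u1 p1.
have m10 := norm1_neq0 m11; have m20 := norm1_neq0 m21.
have m30 := norm1_neq0 m31.
pose s1 := m2 / m3 - m3 / m2; pose s2 := m3 / m1 - m1 / m3.
pose s3 := m1 / m2 - m2 / m1.
have lt1 : `|m1 * m2 + m2 * m3 + m3 * m1| < 1 by rewrite e2 normrN.
have s31 : 0 < - (s3 * s1) by exact: sine_prod_gt0.
have s32 : 0 < - (s2 * s3).
  by apply: sine_prod_gt0 => //; rewrite -addrA addrC.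
(* These are p / m1^2, p / m2^2, p / m3^2 with p = - m1 m2 m3. *)
pose x := - (m2 * m3 / m1); pose y := - (m3 * m1 / m2); pose z := - (m1 * m2 / m3).
have nM (a b c : C) : `|a| = 1 -> `|b| = 1 -> `|c| = 1 -> `|- (a * b / c)| = 1.
  by move=> a1 b1 c1; rewrite normrN !normrM normfV a1 b1 c1 invr1 !mulr1.
have x1 : `|x| = 1 by exact: nM.
have y1 : `|y| = 1 by exact: nM.
have z1 : `|z| = 1 by exact: nM.
have s30 : s3 != 0.
  by apply/negP => /eqP s30; move: s31; rewrite s30 mul0r oppr0 ltxx.
(* The common phase: since s3^* = - s3, [tau] is i or -i, and |s| = - s [tau] for each of the three
   sines. *)
pose tau := s3 / `|s3|.
have conjs (a b : C) : `|a| = 1 -> `|b| = 1 -> (a / b - b / a)^* = - (a / b - b / a).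
  move=> a1 b1; rewrite rmorphB !rmorphM /= !norm1_conjC ?normfV ?a1 ?b1 ?invr1//.
  by rewrite !invrK; ring.
have n30 : `|s3| != 0 by rewrite normr_eq0.
have s3E : `|s3| = - s3 * tau.
  apply: (mulIf n30); rewrite -mulrA divfK//.
  have cs3 : s3^* = - s3 by exact: conjs.
  by transitivity (`|s3| ^+ 2); [ring | rewrite normCK cs3; ring].
have nE s : 0 < - (s * s3) -> `|s| = - s * tau.
  move=> s0; apply: (mulIf n30); rewrite -mulrA divfK// -normrM mulNr.
  by rewrite -normrN gtr0_norm.
have s2E := nE _ s32; have s1E : `|s1| = - s1 * tau by apply: nE; rewrite mulrC.
have yzE : `|y - z| = - s1 * tau.
  have -> : y - z = m1 * s1 by rewrite /y /z /s1; field; rewrite m20 m30.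
  by rewrite normrM m11 mul1r.
have zxE : `|z - x| = - s2 * tau.
  have -> : z - x = m2 * s2 by rewrite /x /z /s2; field; rewrite m10 m30.
  by rewrite normrM m21 mul1r.
have xyE : `|x - y| = - s3 * tau.
  have -> : x - y = m3 * s3 by rewrite /x /y /s3; field; rewrite m10 m20.
  by rewrite normrM m31 mul1r.
exists x, y, z; split=> //.
  by rewrite -[p]opprK -e3 /x /y /z; field; rewrite m10 m20 m30.
have S0 : chord_sum x y z != 0.
  by rewrite chord_sum_eq0 -subr_eq0 -normr_eq0 xyE -s3E (negbTE n30).
apply: (mulfI S0); rewrite chord_sum_uinv /chord_sum xyE yzE zxE.
rewrite -[u]opprK -e2 /x /y /z /s1 /s2 /s3; field.
by rewrite m10 m20 m30.
Qed.

(** * Every ray of C^2 is reached *)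

(** For a != 0 this is a quadratic in U whose roots have product 1, so [r] or its inverse lies in
    the closed disk. *)
Lemma koebe_root (a b : C) :
  exists2 U, `|U| <= 1 & 4 * b * U = a * (1 + U) ^+ 2.
Proof.
have [->|a0] := eqVneq a 0.
  by exists 0; rewrite ?normr0 ?ler01 // mulr0 mul0r.
have [r rE] := @solve_monicpoly C 2 (fun i => nth 0 [:: - 1; 4 * b / a - 2] i) isT.
move: rE; rewrite !big_ord_recl big_ord0 /= expr0 mulr1 addr0 expr1 => rE.
have r0 : r != 0.
  apply/eqP => r0; move/eqP: rE.
  by rewrite r0 mulr0 addr0 expr0n /= eq_sym oppr_eq0 oner_eq0.
have H : 4 * b * r = a * (1 + r) ^+ 2.
  transitivity (a * (1 + 2 * r + (-1 + (4 * b / a - 2) * r))); first by field.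
  by rewrite -rE; ring.
have [r1|r1] := real_leP (normr_real r) (@real1 C); first by exists r.
exists r^-1.
  by rewrite normfV invf_le1 ?normr_gt0// ltW.
apply: (mulfI (expf_neq0 2 r0)).
transitivity (4 * b * r); first by field.
by rewrite H; field.
Qed.

(** On the ray of (a, b) one needs u^3 = N a^3 / |a|^2 and w^2 = N b^2 / |b|. The unknown N drops
    out of their ratio, which leaves Koebe's equation for U = u^3 / p^2. *)
Lemma ray_invariants_surj (a b : C) : `|a| ^+ 2 + `|b| ^+ 2 = 1 ->
  exists u p (N : C), [/\ `|u| <= 1, `|p| = 1, 0 < N,
    `|u| ^+ 2 * u = N * a & `|wpar u p| * wpar u p = N * b].
Proof.
move=> ab1; have [b0|b0] := eqVneq b 0.
  have a1 : `|a| = 1.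
    apply/eqP; rewrite -(@eqrXn2 _ 2)// ?ler01// expr1n.
    by rewrite -ab1 b0 normr0 expr0n addr0.
  (* With u = a, the condition w = 0 amounts to p^2 = - a^3. *)
  have p2 : sqrtC (- a ^+ 3) ^+ 2 = - a ^+ 3 by rewrite sqrtCK.
  have p1 : `|sqrtC (- a ^+ 3)| = 1.
    apply/eqP; rewrite -(@eqrXn2 _ 2)// ?ler01// expr1n -normrX p2.
    by rewrite normrN normrX a1 expr1n.
  move: (sqrtC _) p2 p1 => p p2 p1; have p0 := norm1_neq0 p1.
  exists a, p, 1; split; rewrite ?a1 ?ltr01 ?expr1n//.
  rewrite b0 /wpar (_ : _ / 2 = 0) ?mulr0//.
  by rewrite -[a ^+ 3]opprK -p2; field.
have nb0 : `|b| != 0 by rewrite normr_eq0.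
have [U U1 UE] := koebe_root (a ^+ 3 / `|a| ^+ 2) (b ^+ 2 / `|b|).
have U10 : 1 + U != 0.
  apply: contra_eq_neq UE => U0; rewrite U0 expr0n mulr0.
  have -> : U = - 1 by apply/eqP; rewrite -addr_eq0 addrC U0.
  by rewrite mulrN1 oppr_eq0 !mulf_neq0 ?invr_eq0 ?expf_neq0// pnatr_eq0.
have nU0 : `|1 + U| != 0 by rewrite normr_eq0.
(* As w = p (1 + U) / 2, one has |w| = |1 + U| / 2, and |w| w = N b then fixes N, w and p. The
   equation |u|^2 u = N a gives u = r a; for a = 0 the division by zero is harmless since u = 0. *)
pose N := `|1 + U| ^+ 2 / (4 * `|b|); pose w := b * `|1 + U| / (2 * `|b|).
pose p := 2 * w / (1 + U); pose r := 3.-root (N / `|a| ^+ 2).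
have N0 : 0 < N.
  by rewrite /N divr_gt0 ?exprn_gt0 ?mulr_gt0 ?ltr0n ?normr_gt0.
have nw : `|w| = `|1 + U| / 2.
  rewrite /w !normrM normfV normrM !normr_id normr_nat; field.
  by rewrite nb0.
have p1 : `|p| = 1.
  rewrite /p normrM normfV normrM nw normr_nat; field.
  by rewrite nU0.
have p0 := norm1_neq0 p1.
have r0 : 0 <= r by rewrite rootC_ge0// divr_ge0 ?exprn_ge0// ltW.
have r3 : r ^+ 3 = N / `|a| ^+ 2 by rewrite rootCK.
have u3 : (r * a) ^+ 3 = p ^+ 2 * U.
  rewrite exprMn r3; apply: (mulIf (expf_neq0 2 U10)).
  transitivity (N * (a ^+ 3 / `|a| ^+ 2 * (1 + U) ^+ 2)); first by ring.
  rewrite -UE /p /w /N; field.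
  by rewrite nb0 U10.
have wE : wpar (r * a) p = w.
  rewrite /wpar u3 /p; field.
  by rewrite U10 -normr_eq0 nw mulf_neq0// invr_eq0 pnatr_eq0.
exists (r * a), p, N; split=> //.
- rewrite -(@expr_le1 _ 3)// -normrX u3 normrM normrX p1 expr1n mul1r//.
- rewrite normrM (ger0_norm r0).
  have [->|a0] := eqVneq a 0; first by rewrite !mulr0.
  transitivity (r ^+ 3 * `|a| ^+ 2 * a); first by ring.
  by rewrite r3; field; rewrite normr_eq0.
rewrite wE nw /w /N; field.
by rewrite nb0.
Qed.

Lemma triple_inv_surj (a b : C) : `|a| ^+ 2 + `|b| ^+ 2 = 1 ->
  exists x y z N, [/\ `|x| = 1, `|y| = 1, `|z| = 1 & 0 < N] /\
    `|uinv x y z| ^+ 2 * uinv x y z = N * a /\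
    `|winv x y z| * winv x y z = N * b.
Proof.
move=> /ray_invariants_surj[u [p [N [ule p1 N0 uE wE]]]].
have [x [y [z [x1 y1 z1 xyz xyzu]]]] : exists x y z,
  [/\ `|x| = 1, `|y| = 1, `|z| = 1, x * y * z = p & uinv x y z = u].
  move: ule; rewrite le_eqVlt => /orP[/eqP u1|u1]; last exact: uinv_surj.
  have u0 := norm1_neq0 u1; have p0 := norm1_neq0 p1.
  (* The degenerate triple (s, s, t) with s t = u and s^2 t = p. *)
  exists (p / u), (p / u), (u ^+ 2 / p); split.
  - by rewrite normrM normfV p1 u1 divr1.
  - by rewrite normrM normfV p1 u1 divr1.
  - by rewrite normrM normfV normrX p1 u1 expr1n divr1.
  - by field; rewrite u0 p0.
  - by rewrite uinvxxy; field; rewrite u0 p0.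
by exists x, y, z, N; rewrite /winv xyz xyzu.
Qed.
End Invariants.

(** * Continuity of the invariants *)

Section InvariantsContinuity.
Local Open Scope ring_scope.
Variables (C : numClosedFieldType) (T : topologicalType).
Implicit Types (x y z : T -> C) (t : T).

(** Each weight is at most 1. The bound has no denominator, so it controls [uinv] near a = b = c. *)
Lemma uinv_dist_le (a b c : C) : `|uinv a b c - a * a| <=
  `|b * c - a * a| + `|c * a - a * a| + `|a * b - a * a|.
Proof.
rewrite /uinv !expr2 addrC addKr.
have [/eqP|s0] := eqVneq (chord_sum a b c) 0.
  rewrite chord_sum_eq0 => /andP[/eqP<- /eqP<-].
  by rewrite !subrr !mulr0 !add0r mul0r normr0 addr0.
have sp : 0 < chord_sum a b c by rewrite lt_def s0 chord_sum_ge0.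
rewrite normrM normfV (gtr0_norm sp) ler_pdivrMr//.
have le3 (p q r p' q' r' : C) : p <= p' -> q <= q' -> r <= r' ->
  p + q + r <= p' + q' + r' by move=> *; do !apply: lerD.
apply: le_trans (ler_normD _ _) _.
apply: le_trans (lerD (ler_normD _ _) (lexx _)) _.
rewrite !normrM !normr_id !mulrDl; apply: le3; rewrite mulrC ler_wpM2l//.
- by rewrite /chord_sum -addrA lerDl addr_ge0.
- by rewrite /chord_sum -addrAC lerDr addr_ge0.
- by rewrite /chord_sum lerDr addr_ge0.
Qed.

Lemma continuous_uinv x y z t : {for t, continuous x} -> {for t, continuous y} ->
  {for t, continuous z} -> {for t, continuous (fun s => uinv (x s) (y s) (z s))}.
Proof.
move=> cx cy cz.
have cM (f g : T -> C) : {for t, continuous f} -> {for t, continuous g} ->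
    {for t, continuous (fun s => f s * g s)} by move=> cf cg; exact: cvgM.
have cD (f g : T -> C) : {for t, continuous f} -> {for t, continuous g} ->
    {for t, continuous (fun s => f s + g s)} by move=> cf cg; exact: cvgD.
have cB (f g : T -> C) : {for t, continuous f} -> {for t, continuous g} ->
    {for t, continuous (fun s => f s - g s)} by move=> cf cg; exact: cvgB.
have cN (f : T -> C) : {for t, continuous f} ->
    {for t, continuous (fun s => `|f s| : C)} by move=> cf; exact: (cvg_norm cf).
have [/eqP S0|S0] := eqVneq (chord_sum (x t) (y t) (z t)) 0; last first.
  apply: (cD); first by apply: (cM).
  apply: (cM).
    do !apply: (cD); apply: (cM) => //; try by [apply: (cN); apply: (cB)];
      by apply: (cB); apply: (cM).
  by apply: cvgV => //; do !apply: (cD); apply: (cN); apply: (cB).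
(* At a triple collision the quotient formula gives no continuity; [B] squeezes the difference from
   x^2 to 0. *)
pose B s := `|y s * z s - x s * x s| + `|z s * x s - x s * x s|
  + `|x s * y s - x s * x s|.
have Bt : B t = 0.
  move: S0; rewrite chord_sum_eq0 /B => /andP[/eqP<- /eqP<-].
  by rewrite subrr normr0 !addr0.
have B0 : B @ t --> 0.
  rewrite -Bt; do !apply: (cD); apply: (cN); apply: (cB); exact: (cM).
have -> : (fun s => uinv (x s) (y s) (z s)) =
    (fun s => x s * x s + (uinv (x s) (y s) (z s) - x s * x s)).
  by apply/funext => s; rewrite addrC subrK.
have E : uinv (x t) (y t) (z t) - x t * x t = 0.
  apply/eqP; rewrite -normr_le0; apply: le_trans (uinv_dist_le _ _ _) _.
  by rewrite -/(B t) Bt.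
apply: (cD); first exact: (cM).
rewrite /prop_for /continuous_at E; apply/cvgr0Pnorm_lt => e e0.
near=> s; apply: le_lt_trans (uinv_dist_le _ _ _) _.
rewrite -/(B s) -[ltLHS]ger0_norm ?addr_ge0//.
by near: s; exact: cvgr0_norm_lt.
Unshelve. all: by end_near. Qed.

Lemma continuous_winv x y z t : {for t, continuous x} -> {for t, continuous y} ->
  {for t, continuous z} -> x t * y t * z t != 0 ->
  {for t, continuous (fun s => winv (x s) (y s) (z s))}.
Proof.
move=> cx cy cz p0; rewrite /winv /wpar.
have cp : {for t, continuous (fun s => x s * y s * z s)}.
  by do 2 apply: cvgM => //.
have cu := continuous_uinv cx cy cz.
rewrite (_ : (fun s => _) = (fun s => (x s * y s * z s +
  uinv (x s) (y s) (z s) * (uinv (x s) (y s) (z s) * uinv (x s) (y s) (z s))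
    / (x s * y s * z s))
   / 2)); last by apply/funext => s.
apply: cvgM; last exact: cvg_cst.
apply: cvgD => //; apply: cvgM; last exact: cvgV.
by do 2 apply: cvgM => //.
Qed.

Lemma continuousX_for (f : T -> C) n t : {for t, continuous f} ->
  {for t, continuous (fun s => f s ^+ n)}.
Proof.
move=> cf; elim: n => [|n IH].
  by rewrite (_ : (fun _ => _) = cst 1) //; exact: cvg_cst.
rewrite (_ : (fun _ => _) = (fun s => f s * f s ^+ n)); first exact: cvgM.
by apply/funext => s; rewrite exprS.
Qed.

Lemma continuous_weight (u w : T -> C) t : {for t, continuous u} ->
  {for t, continuous w} -> {for t, continuous (fun s => `|u s| ^+ 6 + `|w s| ^+ 4)}.
Proof.
move=> cu cw.
have cnu : {for t, continuous (fun s => `|u s| : C)} by exact: (cvg_norm cu).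
have cnw : {for t, continuous (fun s => `|w s| : C)} by exact: (cvg_norm cw).
by apply: cvgD; exact: continuousX_for.
Qed.

Lemma continuous_ray (m u w : T -> C) t : {for t, continuous m} ->
  {for t, continuous u} -> {for t, continuous w} ->
  {for t, continuous
     (fun s => (m s * (`|u s| ^+ 2 * u s), m s * (`|w s| * w s)))}.
Proof.
move=> cm cu cw.
have cnu : {for t, continuous (fun s => `|u s| : C)} by exact: (cvg_norm cu).
have cnw : {for t, continuous (fun s => `|w s| : C)} by exact: (cvg_norm cw).
have c1 : {for t, continuous (fun s => m s * (`|u s| ^+ 2 * u s))}.
  by apply: cvgM => //; apply: cvgM => //; exact: continuousX_for.
have c2 : {for t, continuous (fun s => m s * (`|w s| * w s))}.
  by apply: cvgM => //; apply: cvgM.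
exact: (cvg_pair c1 c2).
Qed.
End InvariantsContinuity.

(** * General topology *)

Section Topology.

(** A filter on the subspace is pushed forward to X, where it has a cluster point in A. *)
Lemma compact_set_type (X : topologicalType) (A : set X) :
  compact A -> compact [set: A].
Proof.
move=> cA F FF _.
have FA : (set_val @ F) A.
  by apply: (@filterS _ F _ setT) => [a _|]; [exact: set_valP|exact: filterT].
have [p [Ap clp]] := cA (set_val @ F) _ FA.
exists (exist _ p (mem_set Ap)); split=> // U V FU [W [[W' oW' <-] /= W'p] WV].
have FU' : (set_val @ F) (set_val @` U).
  by apply: (@filterS _ F _ U) => // a Ua; exists a.
have [_ [[a Ua <-] W'a]] := clp _ W' FU' (open_nbhs_nbhs (conj oW' W'p)).
by exists a; split=> //; exact: WV.
Qed.

Lemma continuous_set_type (X Y : topologicalType) (A : set Y) (f : X -> A) :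
  continuous (set_val \o f) -> continuous f.
Proof. exact: (@continuous_comp_initial _ _ _ set_val). Qed.

Lemma continuous_ptws (X : topologicalType) (I : Type) (Y : topologicalType)
    (f : X -> {ptws I -> Y}) :
  (forall i, continuous (fun x => f x i)) -> continuous f.
Proof.
move=> cf x; apply/cvg_sup => i.
apply: (@continuous_comp_initial _ X Y (@^~ i) f); exact: cf.
Qed.

Lemma hausdorff_inj (X Y : topologicalType) (f : X -> Y) :
  hausdorff_space Y -> continuous f -> injective f -> hausdorff_space X.
Proof.
move=> hY cf injf x y xy; apply/injf/hY => U V Ux Vy.
have [t [Ut Vt]] := xy _ _ (cf x _ Ux) (cf y _ Vy).
by exists (f t).
Qed.

Lemma compact_continuous_image (X Y : topologicalType) (f : X -> Y) (A : set X) :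
  continuous f -> compact A -> compact (f @` A).
Proof. by move=> cf; apply: continuous_compact; exact: continuous_subspaceT. Qed.

Lemma compact_hausdorff_homeomorphism (X Y : topologicalType) (f : X -> Y) :
  compact [set: X] -> hausdorff_space Y -> continuous f -> injective f ->
  (forall y, exists x, f x = y) -> homeomorphism f.
Proof.
move=> cX hY cf injf surf; split=> //.
pose g y := sval (cid (surf y)).
have gK : cancel g f by move=> y; rewrite /g; case: cid.
have fK : cancel f g by move=> x; apply: injf; rewrite gK.
exists g; split=> //; apply/continuous_closedP => A cA.
have -> : g @^-1` A = f @` A.
  by apply/seteqP; split=> [y Agy|_ [x Ax <-]]; [exists (g y)|rewrite /= fK].
apply: compact_closed => //; apply: compact_continuous_image => //.
exact: subclosed_compact cA cX _.
Qed.

End Topology.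

(** * From Sub_3 to the sphere *)

Section ComplexTopology.
Local Open Scope ring_scope.
Local Open Scope complex_scope.
Variable R : realType.

Lemma continuous_Re : continuous (@complex.Re R : R[i]^o -> R).
Proof.
move=> z; have zF := nbhs_filter (z : R[i]^o).
apply/(@cvgrPdist_lt _ _ _ (nbhs (z : R[i]^o)) zF) => e e0.
have e0' : 0 < e%:C by rewrite ltcR.
apply: (@filterS _ (nbhs (z : R[i]^o)) zF) (@nbhsx_ballx _ (R[i]^o) z _ e0').
move=> t.
rewrite -ball_normE /= -ltcR; apply: le_lt_trans.
by rewrite -raddfB; exact: normc_ge_Re.
Qed.

Lemma continuous_real_complex : continuous (fun x : R => x%:C : R[i]^o).
Proof.
move=> x; apply/cvgrPdist_lt => e e0.
have eE : e = (complex.Re e)%:C by rewrite RRe_real// gtr0_real.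
have e0' : 0 < complex.Re e by rewrite -ltcR -eE.
apply: (@filterS _ (nbhs x) (nbhs_filter x)) (@nbhsx_ballx _ R x _ e0') => t.
rewrite -ball_normE /= -ltcR -eE; apply: le_lt_trans.
by rewrite -rmorphB normc_def /= expr0n /= addr0 sqrtr_sqr.
Qed.

End ComplexTopology.

(** * Radial projection to the unit sphere *)

Section ToSphere.
Local Open Scope ring_scope.
Local Open Scope complex_scope.
Variable R : realType.
Implicit Types u w p : R[i].

(** The Euclidean norm of (|u|^2 u, |w| w). The real part is taken because moduli in [R[i]] are
    themselves complex numbers. *)
Definition ray_norm u w : R := Num.sqrt (complex.Re (`|u| ^+ 6 + `|w| ^+ 4)).

(* Scaling (|u|^2 u, |w| w) by c > 0 multiplies both u^3 and w^2 by c, so a ray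
   determines u^3 / w^2. *)
Definition to_sphere u w : R[i]^o * R[i]^o :=
  ((ray_norm u w)^-1%:C * (`|u| ^+ 2 * u), (ray_norm u w)^-1%:C * (`|w| * w)).

Lemma ray_norm_sqr u w : (ray_norm u w)%:C ^+ 2 = `|u| ^+ 6 + `|w| ^+ 4.
Proof.
have r0 : 0 <= `|u| ^+ 6 + `|w| ^+ 4 by rewrite addr_ge0 ?exprn_ge0.
have rE := RRe_real (ger0_real r0).
rewrite -rmorphXn sqr_sqrtr /= ?rE//.
by rewrite -lecR rE.
Qed.

(** If u = 0 then w = p / 2, which is not 0. *)
Lemma ray_norm_gt0 u p : `|p| = 1 -> 0 < ray_norm u (wpar u p).
Proof.
move=> p1; have p0 := norm1_neq0 p1; rewrite lt_def sqrtr_ge0 andbT.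
apply/eqP => /(congr1 (fun r : R => (r%:C) ^+ 2)).
rewrite ray_norm_sqr rmorph0 expr0n /= => /eqP.
rewrite paddr_eq0 ?exprn_ge0// !expf_eq0 /= !normr_eq0 => /andP[/eqP->].
rewrite /wpar expr0n /= mul0r addr0 mulf_eq0 (negbTE p0) invr_eq0 pnatr_eq0//.
Qed.

Lemma to_sphere_sphere3 u p : `|p| = 1 -> sphere3 R (to_sphere u (wpar u p)).
Proof.
move=> p1; have r0 := ray_norm_gt0 u p1; move: (wpar u p) r0 => w r0.
rewrite /sphere3 /to_sphere /= !(normrX, normrM) !normr_id !exprMn.
rewrite -mulrDr [X in _ * X](_ : _ = (ray_norm u w)%:C ^+ 2); last first.
  by rewrite ray_norm_sqr; ring.
have -> : `|(ray_norm u w)^-1%:C| = (ray_norm u w)^-1%:C.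
  by rewrite ger0_norm// lecR invr_ge0 ltW.
by rewrite -exprMn -rmorphM mulVf ?rmorph1 ?expr1n// gt_eqF.
Qed.

Lemma to_sphere_inj u p u' p' : `|u| <= 1 -> `|u'| <= 1 -> `|p| = 1 -> `|p'| = 1 ->
  to_sphere u (wpar u p) = to_sphere u' (wpar u' p') ->
  u = u' /\ wpar u p = wpar u' p'.
Proof.
move=> u1 u1' p1 p1'; have r0 := ray_norm_gt0 u p1; have r0' := ray_norm_gt0 u' p1'.
have [r r'] : (ray_norm u (wpar u p))%:C != 0 /\ (ray_norm u' (wpar u' p'))%:C != 0.
  by rewrite !fmorph_eq0 !gt_eqF.
move=> [eu ew].
(* Equal projections differ by the ratio of the two norms, which serves as the factor c of
   [ray_invariants_inj]. *)
have c0 : 0 < (ray_norm u' (wpar u' p'))%:C * ((ray_norm u (wpar u p))%:C)^-1.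
  by rewrite -fmorphV -rmorphM ltcR mulr_gt0// invr_gt0.
have cross (X Y : R[i]) : (ray_norm u (wpar u p))^-1%:C * X =
    (ray_norm u' (wpar u' p'))^-1%:C * Y ->
    Y = (ray_norm u' (wpar u' p'))%:C * ((ray_norm u (wpar u p))%:C)^-1 * X.
  by move=> e; rewrite -mulrA -fmorphV e fmorphV mulVKf.
have [||_ -> ->//] := ray_invariants_inj u1 u1' p1 p1' c0.
- exact: cross eu.
- exact: cross ew.
Qed.

Lemma to_sphere_ray u w (a b N : R[i]) : 0 < N -> `|a| ^+ 2 + `|b| ^+ 2 = 1 ->
  `|u| ^+ 2 * u = N * a -> `|w| * w = N * b -> to_sphere u w = (a, b).
Proof.
move=> N0 ab uE wE.
have NE : (ray_norm u w)%:C = N.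
  apply/eqP; rewrite -(@eqrXn2 _ 2)//; [|by rewrite lecR sqrtr_ge0|exact: ltW].
  rewrite ray_norm_sqr.
  have -> : `|u| ^+ 6 = `|N * a| ^+ 2 by rewrite -uE !(normrX, normrM) normr_id; ring.
  have -> : `|w| ^+ 4 = `|N * b| ^+ 2 by rewrite -wE normrM normr_id; ring.
  by rewrite !normrM !exprMn -mulrDr ab mulr1 gtr0_norm.
have VE : (ray_norm u w)^-1%:C = N^-1 by rewrite -NE; exact: fmorphV.
by rewrite /to_sphere uE wE VE !mulKf// gt_eqF.
Qed.

Lemma continuous_to_sphere (T : topologicalType) (u w : T -> R[i]^o) (t : T) :
  {for t, continuous u} -> {for t, continuous w} -> 0 < ray_norm (u t) (w t) ->
  {for t, continuous (fun s => to_sphere (u s) (w s))}.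
Proof.
move=> cu cw r0.
have cr : {for t, continuous (fun s => (ray_norm (u s) (w s))^-1%:C : R[i]^o)}.
  apply: (@continuous_comp _ _ _ (fun s => (ray_norm (u s) (w s))^-1)
    (fun x : R => x%:C : R[i]^o)); last exact: continuous_real_complex.
  apply: cvgV; first by rewrite gt_eqF.
  apply: (@continuous_comp _ _ _
    (fun s => complex.Re (`|u s| ^+ 6 + `|w s| ^+ 4)) Num.sqrt);
    last exact: sqrt_continuous.
  apply: (@continuous_comp _ _ _ (fun s => (`|u s| ^+ 6 + `|w s| ^+ 4) : R[i]^o)
    (@complex.Re R : R[i]^o -> R)); last exact: continuous_Re.
  exact: (@continuous_weight R[i] T u w t cu cw).
exact: (@continuous_ray R[i] T _ u w t cr cu cw).
Qed.

End ToSphere.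

(** * Triples and the sets they enumerate *)

Section Triples.

Definition triple (X : Type) (a b c : X) : {ptws 'I_3 -> X} :=
  fun i => nth a [:: a; b; c] i.

Lemma tripleE (X : Type) (v : {ptws 'I_3 -> X}) :
  v = triple (v (inord 0)) (v (inord 1)) (v (inord 2)).
Proof.
apply/funext => i; case: i => [[|[|[|//]]] hi]; rewrite /triple /=;
  by congr (v _); apply/val_inj; rewrite /= inordK.
Qed. 

Lemma range_triple (X : eqType) (a b c : X) :
  range (triple a b c) = [set` [:: a; b; c]].
Proof.
apply/seteqP; split=> [_ [i _ <-]|t /=].
  by rewrite /= mem_nth.
rewrite !inE => /or3P[] /eqP->; [exists (inord 0)|exists (inord 1)|exists (inord 2)];
  by rewrite // /triple inordK.
Qed. 

(** The swap and the rotation generate all permutations; the third condition handles two-element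
    sets, where either point may be the repeated one. *)
Lemma sym_triple_eq (X : eqType) (Y : Type) (f : X -> X -> X -> Y)
    (x y z x' y' z' : X) :
  (forall a b c, f b a c = f a b c) -> (forall a b c, f b c a = f a b c) ->
  (forall a b, f a a b = f b b a) ->
  [:: x; y; z] =i [:: x'; y'; z'] -> f x y z = f x' y' z'.
Proof.
move=> fswap frot f2 e.
(* [g a b] is the common value on the arrangements of two copies of [a] and one [b]. *)
have [g gE gC] : exists2 g : X -> X -> Y,
  (forall a b, [/\ f a a b = g a b, f a b a = g a b & f b a a = g a b]) &
  forall a b, g a b = g b a.
  exists (fun a b => f a a b) => // a b; split.
have g1 a b : f a a b = g a b by have [] := gE a b.
have g2 a b : f a b a = g a b by have [] := gE a b.
have g3 a b : f b a a = g a b by have [] := gE a b.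
clear gE.
have mem t : (t \in [:: x; y; z]) = (t \in [:: x'; y'; z']) by exact: e.
clear e.
have := mem x; have := mem y; have := mem z.
have := mem x'; have := mem y'; have := mem z'.
rewrite !inE !eqxx ?orbT /= => mz' my' mx' /esym mz /esym my /esym mx.
clear mem.
have p1 := fswap x' y' z'; have p2 := frot x' y' z'; have p3 := frot y' z' x'.
have p4 := fswap y' z' x'; have p5 := fswap z' x' y'.
case/or3P: mx => /eqP ?; case/or3P: my => /eqP ?; case/or3P: mz => /eqP ?; subst => //;
  move: mx' my' mz'; rewrite ?eqxx ?orbT //= => h1 h2 h3;
  try (solve [congruence]);
  repeat match goal with
  | H : is_true (_ || _) |- _ => case/orP: H => H
  | H : (_ || _) = true |- _ => case/orP: H => H
  | H : is_true (_ == _) |- _ => apply (elimT eqP) in H; subst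
  | H : (_ == _) = true |- _ => apply (elimT eqP) in H; subst
  end; rewrite ?(g1, g2, g3); solve [by [] | exact: gC].
Qed. 

End Triples.

(** * The map from Sub_3 of the circle to the sphere *)

Section SubsToSphere.
Local Open Scope ring_scope.
Local Open Scope complex_scope.
Local Open Scope quotient_scope.
Variable R : realType.
Local Notation S1 := (circle R).

Lemma circle_norm (a : S1) : `|set_val a : R[i]| = 1.
Proof. exact: (set_valP a). Qed.

Lemma circle_norm3 (a b c : S1) :
  `|(set_val a : R[i]) * set_val b * set_val c| = 1.
Proof. by rewrite !normrM !circle_norm !mulr1. Qed.

Definition sphere_point (a b c : S1) : sphere3 R :=
  exist (fun q => q \in sphere3 R) _ (mem_set (to_sphere_sphere3
    (uinv (set_val a : R[i]) (set_val b) (set_val c)) (circle_norm3 a b c))).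

Lemma sphere_pointE (a b c : S1) : set_val (sphere_point a b c) =
  to_sphere (uinv (set_val a : R[i]) (set_val b) (set_val c))
    (winv (set_val a : R[i]) (set_val b) (set_val c)).
Proof. by []. Qed.

Lemma sphere_point_eq (a b c a' b' c' : S1) :
  [:: a; b; c] =i [:: a'; b'; c'] -> sphere_point a b c = sphere_point a' b' c'.
Proof.
apply: sym_triple_eq => [x y z|x y z|x y]; apply: val_inj;
  rewrite -!set_valE !sphere_pointE.
- by rewrite uinv_swap winv_swap.
- by rewrite uinv_rot winv_rot.
- rewrite !uinvxxy !winvxxy ?circle_norm//; congr to_sphere; first exact: mulrC.
  by rewrite [in RHS]addrC [in RHS](mulrC (set_val y)).
Qed.

Lemma sphere_point_inj (a b c a' b' c' : S1) :
  sphere_point a b c = sphere_point a' b' c' -> [:: a; b; c] =i [:: a'; b'; c'].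
Proof.
move/(congr1 set_val); rewrite !sphere_pointE => /to_sphere_inj e.
have [||||uu ww] := e; rewrite ?uinv_le1 ?circle_norm ?circle_norm3//.
have := @triple_inv_inj R[i] _ _ _ _ _ _ (circle_norm a) (circle_norm b)
  (circle_norm c) (circle_norm a') (circle_norm b') (circle_norm c') uu ww.
move=> H t; have := H (set_val t).
by rewrite !inE !set_valE !(inj_eq val_inj).
Qed.

Definition sphere_of_tuple (v : {ptws 'I_3 -> S1}) : sphere3 R :=
  sphere_point (v (inord 0)) (v (inord 1)) (v (inord 2)).

Lemma range_tuple (v : {ptws 'I_3 -> S1}) :
  range v = [set` [:: v (inord 0); v (inord 1); v (inord 2)]].
Proof. by rewrite {1}[v]tripleE range_triple. Qed.

(** One direction lets the map descend to subsets, the other makes the descended map injective. *)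
Lemma sphere_of_tuple_range (v v' : {ptws 'I_3 -> S1}) :
  sphere_of_tuple v = sphere_of_tuple v' <-> range v = range v'.
Proof.
rewrite !range_tuple; split=> [/sphere_point_inj e|e].
  by apply/seteqP; split=> t /=; rewrite e.
apply: sphere_point_eq => t.
have := congr1 (fun A : set S1 => A t) e => /= {}e.
by apply/idP/idP => h; [rewrite -e|rewrite e].
Qed.

Lemma continuous_sphere_of_tuple : continuous sphere_of_tuple.
Proof.
apply: continuous_set_type => v.
have cv i : {for v, continuous (fun v : {ptws 'I_3 -> S1} => set_val (v i) : R[i]^o)}.
  apply: (@continuous_comp _ _ _ (fun v : {ptws 'I_3 -> S1} => v i) set_val).
    exact: proj_continuous.
  exact: initial_continuous.
apply: (@continuous_to_sphere R _ _ _ v).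
- exact: (@continuous_uinv R[i] _ _ _ _ v (cv _) (cv _) (cv _)).
- apply: (@continuous_winv R[i] _ _ _ _ v (cv _) (cv _) (cv _)).
  exact: norm1_neq0 (circle_norm3 _ _ _).
- exact: ray_norm_gt0 (circle_norm3 _ _ _).
Qed.

(** Evaluated on a chosen enumeration; [sphere_of_subs_pi] removes the dependence on the choice. *)
Definition sphere_of_subs (A : Subs 3 S1) : sphere3 R := sphere_of_tuple (Subs_repr A).

Lemma sphere_of_subs_pi v : sphere_of_subs (Subs_pi v) = sphere_of_tuple v.
Proof.
apply/sphere_of_tuple_range.
exact: (congr1 (@Subs_set 3 S1) (Subs_reprK (Subs_pi v))).
Qed.

Lemma pi_Subs n (X : Type) (v : {ptws 'I_n.+1 -> X}) :
  \pi_(Subs n.+1 X) v = Subs_pi v.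
Proof. by rewrite unlock. Qed.

Lemma continuous_sphere_of_subs : continuous sphere_of_subs.
Proof.
apply/(@quotient_continuous {ptws 'I_3 -> S1} (Subs 3 S1)).
rewrite (_ : _ \o _ = sphere_of_tuple); first exact: continuous_sphere_of_tuple.
by apply/funext => v /=; rewrite pi_Subs sphere_of_subs_pi.
Qed.

Lemma sphere_of_subs_inj : injective sphere_of_subs.
Proof.
move=> A B /sphere_of_tuple_range e.
by rewrite -[A]Subs_reprK -[B]Subs_reprK; apply: eq_sig_hprop.
Qed.

Lemma sphere_of_subs_surj (q : sphere3 R) : exists A, sphere_of_subs A = q.
Proof.
case: q => [[a b] qP]; have ab : `|a| ^+ 2 + `|b| ^+ 2 = 1 := set_mem qP.
have [x [y [z [N [[x1 y1 z1 N0] [uE wE]]]]]] := triple_inv_surj ab.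
pose c1 (t : R[i]) (t1 : `|t| = 1) : S1 :=
  exist _ (t : R[i]^o) (mem_set (t1 : circle R t)).
exists (Subs_pi (triple (c1 x x1) (c1 y y1) (c1 z z1))).
rewrite sphere_of_subs_pi /sphere_of_tuple /triple !inordK//=.
apply: val_inj; rewrite -set_valE sphere_pointE.
exact: (to_sphere_ray N0 ab uE wE).
Qed.

Lemma sphere3_hausdorff : hausdorff_space (sphere3 R).
Proof.
apply: (@hausdorff_inj _ (R[i]^o * R[i]^o)%type set_val).
- exact: norm_hausdorff.
- exact: initial_continuous.
- exact: val_inj.
Qed.

Lemma Subs3_hausdorff : hausdorff_space (Subs 3 S1).
Proof.
exact: (hausdorff_inj sphere3_hausdorff continuous_sphere_of_subs sphere_of_subs_inj).
Qed.

End SubsToSphere.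

(** * Subsets with at most one or two elements *)

Section SmallSubsets.
Variables (n : nat) (X : eqType).
Local Open Scope card_scope.

Lemma Subs_eq m (A B : Subs m X) : Subs_set A = Subs_set B -> A = B.
Proof. by move=> e; apply: eq_sig_hprop. Qed.

Lemma Subs_set_pi m (v : {ptws 'I_m.+1 -> X}) : Subs_set (Subs_pi v) = range v.
Proof. by []. Qed.

Lemma Subs_leP k (A : Subs n X) :
  Subs_le k.+1 A <-> exists x : {ptws 'I_k.+1 -> X}, Subs_set A = range x.
Proof.
split=> [Ak|[x Ax]]; last first.
  by rewrite /Subs_le /= Ax; have [] := set_mem (range_Subs x).
have [A0 _] := set_mem (valP A).
(* The same subset, viewed in Sub_(k+1), is enumerated by a tuple of length k + 1. *)
pose B : Subs k.+1 X := exist (fun B => B \in [set B : set X | _]) (Subs_set A)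
  (mem_set (conj A0 Ak)).
have [x xE] := Subs_pi_surj B.
by exists x; rewrite -[RHS]/(Subs_set (Subs_pi x)) xE.
Qed.

Lemma range_pair (x : {ptws 'I_2 -> X}) :
  range x = [set` [:: x ord0; x (lift ord0 ord0)]].
Proof.
apply/seteqP; split=> [_ [i _ <-]|t] /=; rewrite !inE.
  by case: (unliftP ord0 i) => [j|] ->; rewrite ?eqxx ?(ord1 j) ?eqxx ?orbT.
by case/orP => /eqP->; [exists ord0|exists (lift ord0 ord0)].
Qed.

End SmallSubsets.

Section SmallTriples.
Variable X : eqType.

Lemma Subs_le1P (A : Subs 3 X) :
  Subs_le 1 A <-> exists a, A = Subs_pi (triple a a a).
Proof.
split=> [/Subs_leP[x Ax]|[a ->]].
  exists (x ord0); apply: Subs_eq; rewrite Ax Subs_set_pi range_triple.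
  apply/seteqP; split=> [_ [i _ <-]|t] /=; rewrite !inE ?orbb.
    by rewrite (ord1 i).
  by move/eqP->; exists ord0.
apply/Subs_leP; exists (fun=> a); rewrite Subs_set_pi range_triple.
apply/seteqP; split=> [t|_ [i _ <-]] /=; rewrite !inE ?orbb ?eqxx//.
by move/eqP->; exists ord0.
Qed.

Lemma Subs_le2P (A : Subs 3 X) :
  Subs_le 2 A <-> exists a b, A = Subs_pi (triple a b b).
Proof.
have e2 (a b : X) : [set` [:: a; b; b]] = [set` [:: a; b]].
  by apply/seteqP; split=> t /=; rewrite !inE orbb.
split=> [/Subs_leP[x Ax]|[a [b ->]]].
  exists (x ord0), (x (lift ord0 ord0)); apply: Subs_eq.
  by rewrite Ax Subs_set_pi range_triple range_pair e2.
apply/Subs_leP; exists (fun i => nth a [:: a; b] i).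
by rewrite Subs_set_pi range_triple range_pair e2.
Qed.

End SmallTriples.

(** * Angles on the circle, compactness, and the trefoil *)

Section CircleParametrization.
Local Open Scope ring_scope.
Local Open Scope complex_scope.
Variable R : realType.
Local Notation S1 := (circle R).

Definition cis (r : R) : R[i] := cos r +i* sin r.

Lemma cisD r s : cis (r + s) = cis r * cis s.
Proof. by rewrite /cis cosD sinD /GRing.mul /= (addrC (sin r * _)). Qed.

Lemma cis0 : cis 0 = 1.
Proof. by rewrite /cis cos0 sin0. Qed.

Lemma cispi : cis pi = - 1.
Proof. by rewrite /cis cospi sinpi; simpc. Qed.

Lemma cis_norm r : `|cis r| = 1.
Proof. by rewrite normc_def /= cos2Dsin2 sqrtr1. Qed.

Lemma cisN r : cis (- r) = (cis r)^-1.
Proof.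
apply: (mulfI (norm1_neq0 (cis_norm r))).
by rewrite -cisD subrr cis0 divff// norm1_neq0 ?cis_norm.
Qed.

Lemma cisD2pi r : cis (r + pi *+ 2) = cis r.
Proof. by rewrite mulr2n cisD (cisD pi pi) cispi mulrN1 opprK mulr1. Qed.

(** The angle is the arc cosine of the real part; the sign of the imaginary part selects the
    alternative. *)
Lemma norm1_cis (c : R[i]) : `|c| = 1 ->
  exists2 r, 0 <= r <= pi & c = cis r \/ c = cis (- r).
Proof.
case: c => a b; rewrite normc_def /= => -[] /(congr1 (fun x => x ^+ 2)).
rewrite sqr_sqrtr ?addr_ge0 ?sqr_ge0// expr1n => ab.
have a1 : -1 <= a <= 1.
  rewrite -ler_norml -[leRHS](normr1 R) -ler_sqr ?nnegrE// !real_normK ?num_real//.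
  by rewrite expr1n -ab lerDl sqr_ge0.
exists (acos a); first by rewrite acos_ge0//= acos_lepi.
have sE : sin (acos a) = `|b|.
  by rewrite sin_acos// -ab addrAC subrr add0r sqrtr_sqr.
rewrite /cis cosN sinN sE acosK ?in_itv//=.
by case: (ler0P b) => _; [right; rewrite opprK|left].
Qed.

Definition circle_cis (r : R) : S1 :=
  exist (fun z : R[i]^o => z \in S1) (cis r : R[i]^o)
    (mem_set (cis_norm r : S1 (cis r))).

Lemma circle_cisE r : set_val (circle_cis r) = cis r.
Proof. by []. Qed.

Lemma circle_cis_surj (a : S1) :
  exists2 r, 0 <= r <= pi & a = circle_cis r \/ a = circle_cis (- r).
Proof.
have [r r01 rE] := norm1_cis (circle_norm a); exists r => //.
by case: rE => rE; [left|right]; apply: val_inj; rewrite -!set_valE.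
Qed.

Lemma continuous_cis : continuous (cis : R -> R[i]^o).
Proof.
move=> r.
have -> : (cis : R -> R[i]^o) = (fun r => (cos r)%:C + 'i%C * (sin r)%:C).
  by apply/funext => s; rewrite [LHS]complexE.
have c1 : {for r, continuous (fun r : R => (cos r)%:C : R[i]^o)}.
  apply: (@continuous_comp _ _ _ (@cos R) (fun x : R => x%:C : R[i]^o)).
    exact: continuous_cos.
  exact: continuous_real_complex.
have c2 : {for r, continuous (fun r : R => (sin r)%:C : R[i]^o)}.
  apply: (@continuous_comp _ _ _ (@sin R) (fun x : R => x%:C : R[i]^o)).
    exact: continuous_sin.
  exact: continuous_real_complex.
exact: (@cvgD R[i] R[i]^o _ _ _ _ _ _ _ c1
  (@cvgM R[i] _ _ _ _ _ _ _ (@cvg_cst R[i]^o _ _ _ _) c2)).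
Qed.

Lemma continuous_circle_cis : continuous circle_cis.
Proof. by apply: continuous_set_type; exact: continuous_cis. Qed.

Lemma circle_compact : compact [set: S1].
Proof.
have -> : [set: S1] = circle_cis @` `[- pi, pi].
  apply/seteqP; split=> // a _.
  have [r /andP[r0 r1] [->|->]] := circle_cis_surj a.
    by exists r => //=; rewrite in_itv/= r1 (le_trans _ r0)// oppr_le0 pi_ge0.
  by exists (- r) => //=; rewrite in_itv/= lerN2 r1 (le_trans _ (pi_ge0 R))// oppr_le0.
apply: compact_continuous_image; first exact: continuous_circle_cis.
exact: segment_compact.
Qed.

Lemma Subs_compact n : compact [set: Subs n.+1 S1].
Proof.
have -> : [set: Subs n.+1 S1] = @Subs_pi n S1 @` setT.
  by apply/seteqP; split=> // A _; have [v <-] := Subs_pi_surj A; exists v.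
apply: (@compact_continuous_image {ptws 'I_n.+1 -> S1}).
  have -> : @Subs_pi n S1 = \pi_(Subs n.+1 S1)%qT.
    by apply/funext => v; rewrite pi_Subs.
  exact: (@pi_continuous {ptws 'I_n.+1 -> S1} (Subs n.+1 S1)).
rewrite (_ : setT = [set f : 'I_n.+1 -> S1 | forall i, [set: S1] (f i)]).
  exact: (@tychonoff _ (fun=> S1) _ (fun=> circle_compact)).
by apply/seteqP; split.
Qed.

Lemma homeomorphism_sphere_of_subs : homeomorphism (@sphere_of_subs R).
Proof.
apply: compact_hausdorff_homeomorphism.
- exact: Subs_compact.
- exact: sphere3_hausdorff.
- exact: continuous_sphere_of_subs.
- exact: sphere_of_subs_inj.
- exact: sphere_of_subs_surj.
Qed.

(** Here u = z^2 and w = z^3 are unimodular, so the norm divided out is the square root of 1 + 1. *)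
Lemma sphere_of_subs_single (a : S1) :
  set_val (sphere_of_subs (Subs_pi (triple a a a))) =
  ((set_val a : R[i]^o) ^+ 2 / (Num.sqrt 2 : R)%:C,
   (set_val a : R[i]^o) ^+ 3 / (Num.sqrt 2 : R)%:C).
Proof.
rewrite sphere_of_subs_pi /sphere_of_tuple /triple !inordK//= sphere_pointE.
have a1 := circle_norm a; set z : R[i] := set_val a in a1 *.
have uE : uinv z z z = z ^+ 2 by rewrite uinvxxy.
have wE : winv z z z = z ^+ 3.
  by rewrite winvxxy//; field.
have rE : ray_norm (z ^+ 2) (z ^+ 3) = Num.sqrt 2.
  by rewrite /ray_norm !normrX a1 !expr1n.
rewrite uE wE /to_sphere rE !normrX a1 !expr1n !mul1r fmorphV.
by congr pair; rewrite mulrC.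
Qed.

Lemma sphere_of_subs_trefoil :
  @sphere_of_subs R @` Subs_le 1 = trefoil R.
Proof.
apply/seteqP; split=> [_ [A /Subs_le1P[a ->] <-]|q [z z1 qE]].
  by exists (set_val a); [exact: circle_norm|exact: sphere_of_subs_single].
pose a : S1 := exist (fun z : R[i]^o => z \in S1) z (mem_set z1).
exists (Subs_pi (triple a a a)); first by apply/Subs_le1P; exists a.
by apply: val_inj; rewrite -!set_valE qE; exact: sphere_of_subs_single.
Qed.

End CircleParametrization.

(** * The Moebius band *)

Section Moebius.
Local Open Scope ring_scope.
Local Open Scope complex_scope.
Variable R : realType.
Local Notation S1 := (circle R).
Implicit Types x t r s : R.

(** The injective map to the sphere is reused: on pairs its invariants are ab and ab(a + b) / 2. *)
Lemma Subs_pair_inj (a b a' b' : S1) :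
  Subs_pi (triple a b b) = Subs_pi (triple a' b' b') ->
  (set_val a : R[i]) * set_val b = set_val a' * set_val b' /\
  (set_val a : R[i]) + set_val b = set_val a' + set_val b'.
Proof.
move=> /(congr1 (@sphere_of_subs R)); rewrite !sphere_of_subs_pi.
rewrite /sphere_of_tuple /triple !inordK//= => /(congr1 set_val).
rewrite !sphere_pointE => /to_sphere_inj e.
have [||||uu ww] := e; rewrite ?uinv_le1 ?circle_norm ?circle_norm3//.
have {}uu : (set_val a : R[i]) * set_val b = set_val a' * set_val b'.
  by rewrite -!uinvxyy.
have {}ww : winv (set_val a : R[i]) (set_val b) (set_val b) =
  winv (set_val a' : R[i]) (set_val b') (set_val b') by exact: ww.
move: ww; rewrite !winvxyy ?circle_norm// uu.
have ab0 : (set_val a' : R[i]) * set_val b' != 0.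
  by rewrite mulf_neq0// norm1_neq0// circle_norm.
have t0 : (2%:R : R[i])^-1 != 0 by rewrite invr_eq0 pnatr_eq0.
by move=> /(mulIf t0)/(mulfI ab0).
Qed.

Lemma Subs_pair_sym (a b : S1) : Subs_pi (triple a b b) = Subs_pi (triple b a a).
Proof.
apply: Subs_eq; rewrite !Subs_set_pi !range_triple.
by apply/seteqP; split=> u /=; rewrite !inE !orbb orbC.
Qed.

(** The product of the two points is exp (2 i pi x) and their sum is 2 exp (i pi x) cos (pi t). One
    point is repeated to fill a triple. *)
Definition chord x t : Subs 3 S1 :=
  Subs_pi (triple (circle_cis (pi * (x + t))) (circle_cis (pi * (x - t)))
    (circle_cis (pi * (x - t)))).

Lemma circle_cisD2pi r : circle_cis (r + pi *+ 2) = circle_cis r.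
Proof. by apply: val_inj; rewrite -!set_valE !circle_cisE cisD2pi. Qed.

(** On the left the angles are pi (2 - t) and pi t; modulo 2 pi the two points have exchanged
    roles. *)
Lemma chord_glue t : chord 1 (1 - t) = chord 0 t.
Proof.
rewrite /chord Subs_pair_sym; congr (Subs_pi (triple _ _ _)).
- by congr circle_cis; ring.
- by rewrite -[RHS]circle_cisD2pi; congr circle_cis; ring.
- by rewrite -[RHS]circle_cisD2pi; congr circle_cis; ring.
Qed.

Lemma cisDN r : cis r + cis (- r) = 2 * (cos r)%:C.
Proof. by rewrite /cis cosN sinN mulr_natl mulr2n; simpc. Qed.

Lemma cos_pi_inj t u : 0 <= t <= 1 -> 0 <= u <= 1 ->
  cos (pi * t) = cos (pi * u) -> t = u.
Proof.
have pi0 := pi_gt0 R.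
have I v : 0 <= v <= 1 -> pi * v \in `[0, pi].
  move=> /andP[v0 v1]; rewrite in_itv /= mulr_ge0 ?pi_ge0//=.
  by rewrite -[leRHS]mulr1 ler_wpM2l ?pi_ge0.
move=> /I t01 /I u01 /(cos_inj t01 u01) /mulfI; apply.
by rewrite gt_eqF.
Qed.

(** With d = |x - y|, the hypothesis gives sin (pi d) = 0, while the sine is positive on the open
    interval from 0 to pi. *)
Lemma cis_pi2_eq x y : 0 <= x <= 1 -> 0 <= y <= 1 ->
  cis (pi * (x *+ 2)) = cis (pi * (y *+ 2)) -> x = y \/ `|x - y| = 1.
Proof.
move=> x01 y01 e; pose d := `|x - y|.
have d01 : 0 <= d <= 1.
  rewrite /d normr_ge0 /= ler_norml; move: x01 y01; lra.
have : cis (pi * ((x - y) *+ 2)) = 1.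
  have -> : pi * ((x - y) *+ 2) = pi * (x *+ 2) + - (pi * (y *+ 2)) by ring.
  by rewrite cisD cisN e divff// norm1_neq0// cis_norm.
move/(congr1 (@complex.Re R)) => /= c1.
have s0 : sin (pi * d) = 0.
  have : cos ((pi * d) *+ 2) = 1.
    rewrite -mulrnAr /d; case: (ger0P (x - y)) => _ //.
    rewrite (_ : pi * (- (x - y) *+ 2) = - (pi * ((x - y) *+ 2))) ?cosN//; ring.
  rewrite cos_mulr2n cos2sin2 => /eqP; rewrite -subr_eq0 => /eqP c2.
  apply/eqP; rewrite -sqrf_eq0; apply/eqP; move: c2; lra.
have [d0|d0] := eqVneq d 0.
  by left; apply/eqP; rewrite -subr_eq0 -normr_eq0 -/d d0.
have [d1|d1] := eqVneq d 1; first by right.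
have : 0 < sin (pi * d).
  apply: sin_gt0_pi; rewrite mulr_gt0 ?pi_gt0//=; last first.
    by rewrite lt_def d0; case/andP: d01.
  by rewrite -[ltRHS]mulr1 ltr_pM2l ?pi_gt0// lt_neqAle d1; case/andP: d01.
by rewrite s0 ltxx.
Qed.

(** The product determines x up to exchanging 0 and 1. The sum then determines cos (pi t), up to a
    sign when x is exchanged, and that sign turns t into 1 - t. *)
Lemma chord_inj x t y u : 0 <= x <= 1 -> 0 <= t <= 1 -> 0 <= y <= 1 -> 0 <= u <= 1 ->
  chord x t = chord y u ->
  [\/ x = y /\ t = u, [/\ x = 0, y = 1 & u = 1 - t] | [/\ x = 1, y = 0 & u = 1 - t]].
Proof.
move=> x01 t01 y01 u01 /Subs_pair_inj; rewrite !circle_cisE => -[e s].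
have E x' t' : cis (pi * (x' + t')) = cis (pi * x') * cis (pi * t').
  by rewrite mulrDr cisD.
have xy : cis (pi * (x *+ 2)) = cis (pi * (y *+ 2)).
  have D x' t' : cis (pi * (x' *+ 2)) = cis (pi * (x' + t')) * cis (pi * (x' - t')).
    by rewrite -cisD; congr cis; ring.
  by rewrite (D x t) (D y u).
have {}s : cis (pi * x) * (cos (pi * t))%:C = cis (pi * y) * (cos (pi * u))%:C.
  move: s; rewrite !E !mulrN -!mulrDr !cisDN ![cis _ * (2 * _)]mulrCA => /mulfI.
  by apply; rewrite pnatr_eq0.
have [xE|d1] := cis_pi2_eq x01 y01 xy.
  apply: Or31; split=> //; move: s; rewrite xE => /mulfI.
  rewrite norm1_neq0 ?cis_norm// => /(_ isT) [] e2.
  exact: cos_pi_inj e2.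
have cosC v : cos (pi * (1 - v)) = - cos (pi * v).
  by rewrite mulrBr mulr1 cosB cospi sinpi mulN1r mul0r addr0.
have u1 : u = 1 - t -> x = 0 /\ y = 1 \/ x = 1 /\ y = 0 ->
  [\/ x = y /\ t = u, [/\ x = 0, y = 1 & u = 1 - t] | [/\ x = 1, y = 0 & u = 1 - t]].
  by move=> ut [[x0 y1]|[x1 y0]]; [apply: Or32|apply: Or33].
have [[x0 y1]|[x1 y0]] : (x = 0 /\ y = 1) \/ (x = 1 /\ y = 0).
- move: d1; case: (ger0P (x - y)) => h xy1; [right|left]; move: x01 y01 h xy1; lra.
- apply: u1; last by left.
  move: s; rewrite x0 y1 mulr0 mulr1 cis0 cispi mul1r mulN1r -rmorphN => -[] s.
  apply: cos_pi_inj => //; first by move: t01; lra.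
  by rewrite cosC s opprK.
- apply: u1; last by right.
  move: s; rewrite x1 y0 mulr0 mulr1 cis0 cispi mul1r mulN1r -rmorphN => -[] s.
  apply: cos_pi_inj => //; first by move: t01; lra.
  by rewrite cosC.
Qed.

(** Choose x with ab = exp (2 i pi x); then a and b lie at opposite angles from exp (i pi x), and t
    measures that angle. *)
Lemma chord_surj (a b : S1) : exists x t, [/\ 0 <= x <= 1, 0 <= t <= 1 &
  Subs_pi (triple a b b) = chord x t].
Proof.
have pi0 := pi_gt0 R.
have unitp : pi != 0 :> R by rewrite gt_eqF.
have I r : 0 <= r <= pi -> 0 <= r / pi <= 1.
  by move=> /andP[r0 r1]; rewrite divr_ge0 ?pi_ge0//= ler_pdivrMr// mul1r.
have ab1 : `|(set_val a : R[i]) * set_val b| = 1.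
  by rewrite normrM !circle_norm mulr1.
have [x x01 xE] : exists2 x, 0 <= x <= 1 &
    (set_val a : R[i]) * set_val b = cis (pi * (x *+ 2)).
  have [r r01 [->|->]] := norm1_cis ab1.
    exists (r / pi / 2); first by have := I _ r01; lra.
    (* field would unfold pi *)
    by congr cis; move: (pi : R) unitp => P P0; field.
  (* A negative argument is shifted by 2 pi to keep x in the unit interval. *)
  exists (1 - r / pi / 2); first by have := I _ r01; lra.
  by rewrite -cisD2pi; congr cis; move: (pi : R) unitp => P P0; field.
have c1 : `|(set_val a : R[i]) * cis (- (pi * x))| = 1.
  by rewrite normrM circle_norm cis_norm mulr1.
have aE r : (set_val a : R[i]) * cis (- (pi * x)) = cis r ->
    set_val a = cis (pi * x + r).
  by move=> h; rewrite cisD -h cisN mulrCA mulfV ?mulr1// norm1_neq0// cis_norm.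
have bE r : (set_val a : R[i]) = cis (pi * x + r) ->
    set_val b = cis (pi * x - r).
  move=> ar; have a0 := norm1_neq0 (circle_norm a).
  by apply: (mulfI a0); rewrite xE ar -cisD; congr cis; ring.
have [r r01 rE] := norm1_cis c1; exists x, (r / pi); split=> //; first exact: I.
have rp : pi * (r / pi) = r by rewrite mulrC divfK.
have vE (c : S1) s : (set_val c : R[i]) = cis s -> c = circle_cis s.
  by move=> cs; apply: val_inj; rewrite -!set_valE.
rewrite /chord mulrDr mulrBr rp.
case: rE => /aE ar; have br := bE _ ar; rewrite (vE _ _ ar) (vE _ _ br) //.
by rewrite opprK Subs_pair_sym.
Qed.

(** The edge t = 0 covers the angles from 0 to pi, the edge t = 1 those from - pi to 0. *)
Lemma chord_single (a : S1) : exists2 p : R * R, strip p /\ (p.2 = 0 \/ p.2 = 1) &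
  Subs_pi (triple a a a) = chord p.1 p.2.
Proof.
have pi0 := pi_gt0 R.
have unitp : pi != 0 :> R by rewrite gt_eqF.
have I r : 0 <= r <= pi -> 0 <= r / pi <= 1.
  by move=> /andP[r0 r1]; rewrite divr_ge0 ?pi_ge0//= ler_pdivrMr// mul1r.
have [r r01 [->|->]] := circle_cis_surj a.
  exists (r / pi, 0); first by split; [split; rewrite /= in_itv /= ?I ?lexx ?ler01|left].
  by rewrite /chord /=; congr (Subs_pi (triple _ _ _)); congr circle_cis;
    move: (pi : R) unitp => P P0; field.
exists (1 - r / pi, 1).
  split; last by right.
  split; rewrite /= in_itv /= ?lexx ?ler01//.
  by have := I _ r01; lra.
rewrite /chord /=; congr (Subs_pi (triple _ _ _)).
- rewrite -[LHS]circle_cisD2pi; congr circle_cis.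
  by move: (pi : R) unitp => P P0; field.
- by congr circle_cis; move: (pi : R) unitp => P P0; field.
- by congr circle_cis; move: (pi : R) unitp => P P0; field.
Qed.

Lemma chord_le2 x t : Subs_le 2 (chord x t).
Proof. by apply/Subs_le2P; eexists; eexists. Qed.

Definition strip_chord (p : @strip R) : (Subs_le 2 : set (Subs 3 S1)) :=
  exist (fun A => A \in Subs_le 2) (chord (set_val p).1 (set_val p).2)
    (mem_set (chord_le2 _ _)).

(** Yields both the descent to the band and injectivity there. *)
Lemma strip_chordP (p q : @strip R) :
  strip_chord p = strip_chord q <-> strip_glue p q.
Proof.
have strip01 (r : @strip R) : 0 <= (set_val r).1 <= 1 /\ 0 <= (set_val r).2 <= 1.
  by have [] := set_valP r; rewrite /= !in_itv.
have [x01 t01] := strip01 p; have [y01 u01] := strip01 q.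
rewrite /strip_glue; split.
  move=> /(congr1 set_val); rewrite /= => /chord_inj.
  case: (set_val p) (set_val q) x01 t01 y01 u01 => [x t] [y u] /= x01 t01 y01 u01.
  case=> // [[-> ->]|[-> -> ->]|[-> -> ->]]; by rewrite !eqxx ?orbT.
move=> e; apply: val_inj => /=; move: e.
case: (set_val p) (set_val q) => [x t] [y u] /=.
case/or3P=> [/andP[/eqP-> /eqP->]//||] /and3P[/eqP-> /eqP-> /eqP->].
  by rewrite chord_glue.
by rewrite -chord_glue subKr.
Qed.

End Moebius.

(** * The homeomorphism from the band to Sub_2, and its boundary *)

Section MoebiusHomeomorphism.
Local Open Scope ring_scope.
Local Open Scope quotient_scope.
Variable R : realType.
Local Notation S1 := (circle R).

Lemma continuous_strip_chord : continuous (@strip_chord R).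
Proof.
apply: continuous_set_type.
pose v (p : @strip R) : {ptws 'I_3 -> S1} :=
  triple (circle_cis (pi * ((set_val p).1 + (set_val p).2)))
    (circle_cis (pi * ((set_val p).1 - (set_val p).2)))
    (circle_cis (pi * ((set_val p).1 - (set_val p).2))).
have -> : set_val \o @strip_chord R = \pi_(Subs 3 S1) \o v.
  by apply/funext => p; rewrite /= pi_Subs.
move=> p; apply: (@continuous_comp _ {ptws 'I_3 -> S1} (Subs 3 S1)); last first.
  exact: pi_continuous.
have cv : continuous v; last exact: cv.
apply: continuous_ptws => i {}p.
have cval : {for p, continuous (fun p : @strip R => set_val p : R * R)}.
  exact: initial_continuous.
have c1 : {for p, continuous (fun p : @strip R => (set_val p).1)}.
  apply: (cvg_comp _ _ cval); exact: cvg_fst.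
have c2 : {for p, continuous (fun p : @strip R => (set_val p).2)}.
  apply: (cvg_comp _ _ cval); exact: cvg_snd.
have cc (f : @strip R -> R) : {for p, continuous f} ->
    {for p, continuous (fun p => circle_cis (pi * f p))}.
  move=> cf; apply: (@continuous_comp _ _ _ (fun p => pi * f p) (@circle_cis R)).
    apply: (@continuous_comp (@strip R) R R f ( *%R pi)) => //.
    exact: mulrl_continuous.
  exact: continuous_circle_cis.
have cD := cc _ (cvgD c1 c2); have cB := cc _ (cvgB c1 c2).
by case: i => [[|[|[|//]]] hi]; [exact: cD|exact: cB|exact: cB].
Qed.

Lemma strip_compact : compact [set: @strip R].
Proof.
by apply: compact_set_type; apply: compact_setX; exact: segment_compact.
Qed.

Lemma moebius_compact : compact [set: moebius R].
Proof.
have -> : [set: moebius R] = \pi_(moebius R) @` setT.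
  by apply/seteqP; split=> // m _; exists (repr m) => //; rewrite reprK.
apply: compact_continuous_image; last exact: strip_compact.
exact: pi_continuous.
Qed.

Definition moebius_chord (m : moebius R) : (Subs_le 2 : set (Subs 3 S1)) :=
  strip_chord (repr m).

Lemma moebius_chord_pi p : moebius_chord (\pi_(moebius R) p) = strip_chord p.
Proof.
apply/strip_chordP; have := reprK (\pi_(moebius R) p).
by move=> e; apply/(@eqmodP _ (strip_glue_equiv R)); exact: e.
Qed.

Lemma continuous_moebius_chord : continuous moebius_chord.
Proof.
apply/(@quotient_continuous (@strip R) {eq_quot strip_glue_equiv R}).
rewrite (_ : _ \o _ = @strip_chord R); first exact: continuous_strip_chord.
by apply/funext => p; exact: moebius_chord_pi.
Qed.

Lemma moebius_chord_inj : injective moebius_chord.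
Proof.
move=> m n /strip_chordP mn; rewrite -[m]reprK -[n]reprK.
by apply/(@eqmodP _ (strip_glue_equiv R)).
Qed.

Lemma moebius_chord_surj A : exists m, moebius_chord m = A.
Proof.
have /Subs_le2P[a [b AE]] := set_valP A.
have [x [t [x01 t01 xtE]]] := chord_surj a b.
have xt : (x, t) \in @strip R by apply/mem_set; split; rewrite /= in_itv.
exists (\pi_(moebius R) (exist (fun p => p \in @strip R) (x, t) xt)).
by rewrite moebius_chord_pi; apply: val_inj; rewrite /= -xtE -AE.
Qed.

Lemma homeomorphism_moebius_chord : homeomorphism moebius_chord.
Proof.
apply: compact_hausdorff_homeomorphism.
- exact: moebius_compact.
- apply: (hausdorff_inj (@Subs3_hausdorff R) (f := set_val)).
    exact: initial_continuous.
  exact: val_inj.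
- exact: continuous_moebius_chord.
- exact: moebius_chord_inj.
- exact: moebius_chord_surj.
Qed.

Lemma moebius_chord_boundary :
  [set set_val (moebius_chord m) | m in moebius_boundary R] = Subs_le 1.
Proof.
apply/seteqP; split=> [_ [_ [p pb <-] <-]|A /Subs_le1P[a ->]].
  rewrite moebius_chord_pi; apply/Subs_le1P.
  have {}pb : (set_val p).2 = 0 \/ (set_val p).2 = 1 := pb.
  rewrite (_ : set_val _ = chord (set_val p).1 (set_val p).2) // /chord.
  (* At t = 0 the two angles coincide; at t = 1 they differ by 2 pi. *)
  case: pb => ->; first by eexists; rewrite addr0 subr0.
  exists (circle_cis (pi * ((set_val p).1 - 1))).
  rewrite (_ : pi * ((set_val p).1 + 1) =
    pi * ((set_val p).1 - 1) + pi *+ 2); last by ring.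
  by rewrite circle_cisD2pi.
have [p [ps pb] pE] := chord_single a.
exists (\pi_(moebius R) (exist (fun p => p \in @strip R) p (mem_set ps))).
  by exists (exist (fun p => p \in @strip R) p (mem_set ps)).
by rewrite moebius_chord_pi pE.
Qed.

End MoebiusHomeomorphism.

Theorem mainTheorem1 (R : realType) :
  (exists h : Subs 3 (circle R) -> sphere3 R,
     homeomorphism h /\ h @` Subs_le 1 = trefoil R) /\
  (exists g : moebius R -> (Subs_le 2 : set (Subs 3 (circle R))),
     homeomorphism g /\
     [set set_val (g p) | p in moebius_boundary R] = Subs_le 1).
Proof.
split.
  exists (@sphere_of_subs R); split; first exact: homeomorphism_sphere_of_subs.
  exact: sphere_of_subs_trefoil.
exists (@moebius_chord R); split; first exact: homeomorphism_moebius_chord.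
exact: moebius_chord_boundary.
Qed.
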